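(* Let $n\ge 1$, $1<p<\infty$, let $R\subset\mathbb R^{n+1}$ be a parabolic rectangle, and let $0\le\gamma<1$, $\gamma<\alpha<1$ and $0<q\le1$. Assume that $f\in \mathrm{PBMO}^+_{\gamma,q}(R)$ and let $\|f\|=\|f\|_{\mathrm{PBMO}^+_{\gamma,q}(R)}$, with $\|f\|>0$. Then there exist a constant $c_R\in\mathbb R$ and positive constants $A$, $B$, $C$, depending only on $n,p,q,\gamma,\alpha$, such that \[ |R^{+}(\alpha)\cap\{(f-c_{R})_+>\lambda\}|\le e^{-B(\lambda/\|f\|)^q}\,\frac{A}{\|f\|^q}\int_{R^{+}(\gamma)}(f-c_{R})_+^q \] and \[ |R^{-}(\alpha)\cap\{(f-c_{R})_->\lambda\}|\le e^{-B(\lambda/\|f\|)^q}\,\frac{A}{\|f\|^q}\int_{R^{-}(\gamma)}(f-c_{R})_-^q \] for every $\lambda\ge C\|f\|$.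
   Context: Points of $\mathbb R^{n+1}$ are written $(x,t)$ with $x\in\mathbb R^n$, $t\in\mathbb R$; $|E|$ is Lebesgue measure, integrals are with respect to $dx\,dt$, and $⨍_E g=\frac1{|E|}\int_E g$ denotes the integral average. Write $g_+=\max\{g,0\}$, $g_-=-\min\{g,0\}$. For $x\in\mathbb R^n$ and $L>0$ let $Q(x,L)=\{y\in\mathbb R^n:|y_i-x_i|\le L,\ i=1,\dots,n\}$. A parabolic rectangle (in the $p$-geometry, $1<p<\infty$ fixed) centered at $(x,t)$ with side length $L>0$ is $R=R(x,t,L)=Q(x,L)\times(t-L^p,t+L^p)$. For $-1<\gamma<1$ its upper and lower parts are $R^+(\gamma)=Q(x,L)\times(t+\gamma L^p,t+L^p)$ and $R^-(\gamma)=Q(x,L)\times(t-L^p,t-\gamma L^p)$. For a parabolic rectangle $R$, $0\le\gamma<1$ and $0<q<\infty$, a function $f\in L^q_{\mathrm{loc}}(R)$ belongs to $\mathrm{PBMO}^+_{\gamma,q}(R)$ if \[ \|f\|_{\mathrm{PBMO}^+_{\gamma,q}(R)}=\sup_{P\subset R}\ \inf_{c\in\mathbb R}\Big(⨍_{P^+(\gamma)}(f-c)_+^q+⨍_{P^-(\gamma)}(f-c)_-^q\Big)^{1/q}<\infty, \] where the supremum is over all parabolic rectangles $P\subset R$ (including $R$ itself). *)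

(* Defs.v *)
From HB Require Import structures.
From mathcomp Require Import all_boot all_order all_algebra.
From mathcomp Require Import all_classical all_reals all_analysis.

Set Implicit Arguments.
Unset Strict Implicit.
Unset Printing Implicit Defensive.

Import Order.TTheory GRing.Theory Num.Theory.
Import numFieldNormedType.Exports.
Local Open Scope classical_set_scope.
Local Open Scope ring_scope.

(* 'rV[R]_n carries the sigma-algebra generated by the coordinates, as
   n.-tuple T does in the library. *)
Definition measure_rV_display : measure_display.
Proof. exact: default_measure_display. Qed.

Section measurable_rV.
Context {R : realType} {n : nat}.

Let coord (i : 'I_n) (x : 'rV[R]_n) : measurableTypeR R := x ord0 i.

Let rV_set0 : g_sigma_preimage coord set0.
Proof. exact: sigma_algebra0. Qed.

Let rV_setC A : g_sigma_preimage coord A -> g_sigma_preimage coord (~` A).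
Proof. exact: sigma_algebraC. Qed.

Let rV_bigcup (F : _^nat) : (forall i, g_sigma_preimage coord (F i)) ->
  g_sigma_preimage coord (\bigcup_i (F i)).
Proof. exact: sigma_algebra_bigcup. Qed.

HB.instance Definition _ := @isMeasurable.Build measure_rV_display
  'rV[R]_n (g_sigma_preimage coord) rV_set0 rV_setC rV_bigcup.

Lemma measurable_coord_rV (i : 'I_n) :
  measurable_fun [set: 'rV[R]_n] (coord i).
Proof.
move=> _ Y mY; rewrite setTI; apply: sub_sigma_algebra => /=.
rewrite -bigcup_seq/=; exists i => /=; first by rewrite mem_index_enum.
by exists Y => //; rewrite setTI.
Qed.

Lemma measurable_fun_rV d (T : measurableType d) (f : T -> 'rV[R]_n) :
  (forall i, measurable_fun [set: T] (coord i \o f)) ->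
  measurable_fun [set: T] f.
Proof.
move=> mf _ A mA; rewrite setTI; move: A mA.
suff : g_sigma_preimage coord `<=` [set A | measurable (f @^-1` A)] by [].
apply: smallest_sub.
  split => /=; first by rewrite preimage_set0.
  - by move=> A mA; rewrite setTD preimage_setC; exact: measurableC.
  - by move=> F mF; rewrite preimage_bigcup; exact: bigcup_measurable.
rewrite -bigcup_seq; apply: bigcup_sub => i _ _ [B mB <-] /=.
by have := mf i measurableT B mB; rewrite !setTI.
Qed.

End measurable_rV.

Section lebesgue_rV.
Context {R : realType}.

Definition cons_rV n (z : 'rV[R]_n * measurableTypeR R) : 'rV[R]_n.+1 :=
  row_mx (z.2%:M : 'rV[R]_1) z.1.

Lemma measurable_cons_rV n : measurable_fun setT (@cons_rV n).
Proof.
apply: measurable_fun_rV => i /=.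
case: (split_ordP (i : 'I_(1 + n))) => j ->.
- rewrite (_ : _ \o _ = snd); first exact: measurable_snd.
  apply/funext => z; apply: etrans (row_mxEl _ _ _ _) _.
  by rewrite (ord1 j) mxE eqxx.
- rewrite (_ : _ \o _ = (fun x : 'rV[R]_n => x ord0 j : measurableTypeR R) \o fst).
    exact: measurableT_comp (measurable_coord_rV j) measurable_fst.
  by apply/funext => z; exact: (row_mxEr (z.2%:M : 'rV[R]_1)).
Qed.

Section step.
Variables (n : nat) (mu : {measure set 'rV[R]_n -> \bar R}).

Definition lebesgue_rV_step : set 'rV[R]_n.+1 -> \bar R :=
  pushforward (mu \x @lebesgue_measure R)%E (@cons_rV n).

Let step0 : lebesgue_rV_step set0 = 0%E.
Proof. by rewrite /lebesgue_rV_step /pushforward preimage_set0 measure0. Qed.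

Let step_ge0 A : (0 <= lebesgue_rV_step A)%E.
Proof. exact: (measure_ge0 (mu \x @lebesgue_measure R)%E). Qed.

Let step_sigma_additive : semi_sigma_additive lebesgue_rV_step.
Proof.
move=> F mF tF mUF; rewrite /lebesgue_rV_step /pushforward preimage_bigcup.
have mpre A : measurable A -> measurable (@cons_rV n @^-1` A).
  by move=> mA; rewrite -[X in measurable X]setTI; exact: measurable_cons_rV.
apply: measure_semi_sigma_additive.
- by move=> k; apply: mpre.
- apply/trivIsetP => /= i j _ _ ij; rewrite -preimage_setI.
  by move/trivIsetP : tF => /(_ _ _ _ _ ij) ->//; rewrite preimage_set0.
- by rewrite -preimage_bigcup; exact: mpre.
Qed.

HB.instance Definition _ := isMeasure.Build _ _ _ lebesgue_rV_step
  step0 step_ge0 step_sigma_additive.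

End step.

(* Lebesgue measure on the Borel sets of R^n: the n-fold product of
   lebesgue_measure, new coordinates being added in front. *)
Fixpoint lebesgue_rV n : {measure set 'rV[R]_n -> \bar R} :=
  if n is m.+1 then lebesgue_rV_step (lebesgue_rV m)
  else \d_(0 : 'rV[R]_0).

End lebesgue_rV.

(* Lebesgue measure on R^n x R: completing the Borel product measure makes
   Lebesgue (= Caratheodory) measurable, not just Borel, sets and functions
   measurable. *)
Section lebesgue_spacetime.
Context {R : realType} {n : nat}.

Definition borel_spacetime : set ('rV[R]_n * measurableTypeR R) -> \bar R :=
  (lebesgue_rV n \x @lebesgue_measure R)%E.
HB.instance Definition _ := Measure.on borel_spacetime.

Definition lebesgue_spacetime :=
  @completed_measure_extension _ _ _ borel_spacetime.
HB.instance Definition _ := Measure.on lebesgue_spacetime.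

End lebesgue_spacetime.

(* The domain of lebesgue_spacetime; convertible to 'rV[R]_n * R. *)
Notation spacetime R n := (caratheodory_type (@borel_spacetime R n)^*%mu).

Section parabolic.
Context {R : realType} {n : nat}.
Local Notation mu := (@lebesgue_spacetime R n).
Implicit Types (x y : 'rV[R]_n) (t L p q gamma : R).
Implicit Types (E D K : set ('rV[R]_n * R)) (f g : 'rV[R]_n * R -> R).

Definition cube x L : set 'rV[R]_n :=
  [set y | forall i, `|y ord0 i - x ord0 i| <= L].

Definition prect p x t L : set ('rV[R]_n * R) :=
  cube x L `*` [set` `]t - L `^ p, t + L `^ p[].

Definition prect_upper p gamma x t L : set ('rV[R]_n * R) :=
  cube x L `*` [set` `]t + gamma * L `^ p, t + L `^ p[].

Definition prect_lower p gamma x t L : set ('rV[R]_n * R) :=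
  cube x L `*` [set` `]t - L `^ p, t - gamma * L `^ p[].

Definition integral_average E g : \bar R :=
  ((mu E)^-1 * \int[mu]_(z in E) (g z)%:E)%E.

Definition Lq_loc q D f :=
  measurable_fun (D : set (spacetime R n)) f /\
  forall K, K `<=` D -> compact K ->
    (\int[mu]_(z in K) (`|f z| `^ q)%:E < +oo)%E.

Definition PBMO_oscillation p gamma q f x t L (c : R) : \bar R :=
  ((integral_average (prect_upper p gamma x t L)
      (fun z => (f \- cst c)^\+ z `^ q)%R
    + integral_average (prect_lower p gamma x t L)
      (fun z => (f \- cst c)^\- z `^ q)%R) `^ q^-1)%E.

Definition PBMO_norm p gamma q x t L f : \bar R :=
  ereal_sup [set ereal_inf (range (PBMO_oscillation p gamma q f P.1.1 P.1.2 P.2))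
            | P in [set P : 'rV[R]_n * R * R |
                0 < P.2 /\ prect p P.1.1 P.1.2 P.2 `<=` prect p x t L]].

Definition PBMO p gamma q x t L f :=
  Lq_loc q (prect p x t L) f /\ (PBMO_norm p gamma q x t L f < +oo)%E.

End parabolic.

(* Main.v *)
Require Import Defs.
From mathcomp Require Import all_boot all_order all_algebra.
From mathcomp Require Import all_classical all_reals all_analysis.
From mathcomp Require Import measurable_realfun lra ring.

Set Implicit Arguments.
Unset Strict Implicit.
Unset Printing Implicit Defensive.

Import Order.TTheory GRing.Theory Num.Theory.
Import numFieldNormedType.Exports.
Local Open Scope classical_set_scope.
Local Open Scope ring_scope.

(* Calderon-Zygmund stopping time, without chaining. Cut [R^+(alpha)] into a
   nested grid whose spatial side shrinks by a large factor [2^m] at each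
   generation. To a cell [S] attach the parabolic rectangle [R_S] with the same
   cube and the same top, and a near-optimal constant [c_S] for it: up to a small
   proportion of points and an error [K ||f||], [f <= c_S] on [R_S^+(gamma)] and
   [f >= c_S] on [R_S^-(gamma)]. As [2^m] is large, [R_S'] lies in
   [R_S^+(gamma)] for every proper descendant [S'] of [S], so both facts can be
   compared there:
   - [c_S'] exceeds [c_S] by at most a multiple of [||f||] if [S'] is a child;
   - translate each [S'] with [c_S' > c_S + a] down into [R_S'^-]; the maximal
     translates are disjoint, [f > c_S + a - K ||f||] on half of each, and
     dilating them covers all these [S'], whose union therefore has measure at
     most [C |R_S^+(gamma) /\ {f > c_S + a - K ||f||}|], hence [|S| / 2] if [a] is a
     large multiple of [||f||].
   Off that union [f <= c_S + a + K ||f||] almost everywhere, by density. Iterating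
   gives decay exponential in [lambda / ||f||], which for [q <= 1] is stronger than
   in [(lambda / ||f||)^q]; the factor [||f||^-q \int (f - c_R)_+^q] comes from
   Chebyshev's inequality at the first generation, in [R^+(gamma)]. *)

(** * Stopping-time argument on a nested family of cells *)

(** Countable subadditivity over the cover [V], then additivity over the disjoint [Q j]. *)
Lemma measure_le_of_cover d (T : measurableType d) (R : realType)
    (mu : {measure set T -> \bar R}) (J : countType) (F : set J)
    (Q V : J -> set T) (A B : set T) (k : R) :
  (forall j, F j -> measurable (Q j)) -> (forall j, F j -> measurable (V j)) ->
  measurable A -> measurable B -> trivIset F Q -> A `<=` \bigcup_(j in F) V j ->
  0 <= k -> (forall j, F j -> mu (V j) <= k%:E * mu (B `&` Q j))%E ->
  (mu A <= k%:E * mu B)%E.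
Proof.
move=> mQ mV mA mB tQ AV k0 VQ.
(* Reindexes the family by natural numbers: codes of no element of [F] get the empty set, which
   contributes nothing to the series. *)
pose ix (W : J -> set T) (i : nat) : set T :=
  if pickle_inv i is Some j then if j \in F then W j else set0 else set0.
have ixP W i z : ix W i z -> exists j, [/\ pickle j = i, F j & W j z].
  rewrite /ix; have := @pickle_invK J i.
  case: pickle_inv => [j|//] /= ji; case: ifPn => //; rewrite inE => Fj Wz.
  by exists j.
have ixE W j : F j -> ix W (pickle j) = W j.
  by move=> Fj; rewrite /ix pickleK_inv mem_set.
have mix W : (forall j, F j -> measurable (W j)) -> forall i, measurable (ix W i).
  move=> mW i; rewrite /ix; case: (pickle_inv i) => [j|] //.
  by case: ifPn => //; rewrite inE => /mW.
have mBQ i : measurable (B `&` ix Q i) by apply: measurableI => //; exact: mix.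
have AixV : A `<=` \bigcup_i ix V i.
  by move=> z /AV[j Fj Vz]; exists (pickle j) => //; rewrite ixE.
have /le_trans := measure_sigma_subadditive mu (mix _ mV) mA AixV; apply.
apply: (@le_trans _ _ (\sum_(0 <= i <oo) k%:E * mu (B `&` ix Q i)))%E.
  apply: lee_nneseries => // i _; rewrite /ix.
  case: (pickle_inv i) => [j|]; last by rewrite measure0 setI0 measure0 mule0.
  case: ifPn; last by rewrite measure0 setI0 measure0 mule0.
  by rewrite inE => /VQ.
rewrite nneseriesZl//; apply: lee_wpmul2l; first by rewrite lee_fin.
rewrite -[X in (X <= _)%E](_ : mu (\bigcup_i (B `&` ix Q i)) = _)%E.
  apply: le_measure; rewrite ?inE//; first exact: bigcupT_measurable.
  by move=> z [i _ []].
rewrite measure_bigcup//.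
  by apply: eq_eseriesl => i; rewrite in_setT.
apply/trivIsetP => i i' _ _ ii'; apply/seteqP; split => // z.
move=> [[_ /ixP[j [ji Fj Qz]]] [_ /ixP[j' [ji' Fj' Qz']]]].
have jj' : j = j' by apply: tQ => //; exists z.
by move: ii'; rewrite -ji -ji' jj' eqxx.
Qed.

(** Says that [D] is a union of cells of generation [i]. *)
Definition saturated (T I : Type) (lab : nat -> T -> I) i (D : set T) :=
  forall z z', lab i z = lab i z' -> D z -> D z'.

Section stopping.
Context d (T : measurableType d) (R : realType) (mu : {measure set T -> \bar R}).
Context (I : countType) (lab : nat -> T -> I).

Local Notation saturated := (saturated lab).

Hypothesis mlab : forall i u, measurable [set z | lab i z = u].
Hypothesis lab_refine : forall i z z', lab i.+1 z = lab i.+1 z' -> lab i z = lab i z'.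

Definition cell i z : set T := [set z' | lab i z' = lab i z].

Lemma lab_le i j z z' : (i <= j)%N -> lab j z = lab j z' -> lab i z = lab i z'.
Proof.
elim: j => [|j IH]; first by rewrite leqn0 => /eqP->.
by rewrite leq_eqVlt => /orP[/eqP->//|]; rewrite ltnS => /IH h /lab_refine.
Qed.

Lemma saturated_le i j D : (i <= j)%N -> saturated i D -> saturated j D.
Proof. by move=> ij sD z z' /(lab_le ij); exact: sD. Qed.

Lemma measurable_cell i z : measurable (cell i z).
Proof. exact: mlab. Qed.

Lemma measurable_saturated i D : saturated i D -> measurable D.
Proof.
move=> sD.
have -> : D = \bigcup_u [set z | lab i z = u /\ D z].
  by apply/seteqP; split => [z Dz|z [u _ []]//]; exists (lab i z).
apply: countable_bigcupT_measurable => [//|u].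
have [[z [<- Dz]]|h] := pselect (exists z, lab i z = u /\ D z).
  rewrite (_ : mkset _ = cell i z); first exact: measurable_cell.
  apply/seteqP; split => [z' [//]|z' zz'] /=; split => //.
  by apply: sD Dz.
rewrite (_ : mkset _ = set0)//; apply/seteqP; split => // z zu.
by case: h; exists z.
Qed.

Lemma measurable_level (f : T -> R) a : measurable_fun setT f ->
  measurable [set z | a < f z].
Proof.
move=> mf; rewrite (_ : mkset _ = f @^-1` `]a, +oo[%classic).
  by rewrite -[X in measurable X]setTI; exact: mf.
by apply/seteqP; split => z /=; rewrite in_itv/= andbT.
Qed.

Lemma measurable_lt_level (f : T -> R) a : measurable_fun setT f ->
  measurable [set z | f z < a].
Proof.
move=> mf; rewrite (_ : mkset _ = f @^-1` `]-oo, a[%classic).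
  by rewrite -[X in measurable X]setTI; exact: mf.
by apply/seteqP; split => z /=; rewrite in_itv.
Qed.

Lemma measure_mono (A B : set T) : measurable A -> measurable B -> A `<=` B ->
  (mu A <= mu B)%E.
Proof. by move=> mA mB AB; apply: le_measure; rewrite ?inE. Qed.

Hypothesis lab_approx : forall X G (e : R), measurable X -> measurable G ->
  (mu X < +oo)%E -> 0 < e -> exists i D, saturated i D /\
    (mu (X `&` ((G `\` D) `|` (D `\` G))) <= e%:E)%E.

(** A substitute for Lebesgue's differentiation theorem: a union [D] of cells approximating [G]
    would be nearly filled by [G], while [G] takes up at most half of every cell it meets. *)
Lemma null_of_half_density X G i0 : saturated i0 X -> (mu X < +oo)%E ->
  measurable G -> G `<=` X ->
  (forall z j, G z -> (i0 <= j)%N ->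
     mu (G `&` cell j z) <= (1/2)%:E * mu (cell j z))%E ->
  mu G = 0%E.
Proof.
move=> sX Xoo mG GX dG; have mX := measurable_saturated sX.
have Goo : mu G \is a fin_num.
  by rewrite ge0_fin_numE//; apply: le_lt_trans Xoo; exact: measure_mono.
have [g gE] : exists g, mu G = g%:E by exists (fine (mu G)); rewrite fineK.
have g0 : 0 <= g by rewrite -lee_fin -gE.
rewrite gE; congr _%:E; apply/eqP; rewrite eq_le g0 andbT leNgt; apply/negP => gp.
have [//|i [D [sD dD]]] := lab_approx mX mG Xoo (e := g / 4); first lra.
have sDX : saturated (maxn i i0) (D `&` X).
  move=> z z' zz' [Dz Xz]; split.
    exact: (saturated_le (leq_maxl i i0) sD) Dz.
  exact: (saturated_le (leq_maxr i i0) sX) Xz.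
have mDX := measurable_saturated sDX; have mD := measurable_saturated sD.
have mGD : measurable (X `&` ((G `\` D) `|` (D `\` G))).
  by apply: measurableI => //; apply: measurableU; exact: measurableD.
have h1 : (mu G <= mu (G `&` (D `&` X)) + (g / 4)%:E)%E.
  apply: le_trans (leeD2l _ dD).
  apply: le_trans (measureU2 mu _ mGD); last exact: measurableI.
  apply: measure_mono => //; first by apply: measurableU => //; exact: measurableI.
  move=> z Gz; have Xz := GX _ Gz.
  by have [Dz|nDz] := pselect (D z); [left|right; split => //; left].
have h2 : (mu (D `&` X) <= mu G + (g / 4)%:E)%E.
  apply: le_trans (leeD2l _ dD).
  apply: le_trans (measureU2 mu _ mGD) => //.
  apply: measure_mono => //; first exact: measurableU.
  move=> z [Dz Xz].
  by have [Gz|nGz] := pselect (G z); [left|right; split => //; right].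
have h3 : (mu (G `&` (D `&` X)) <= (1/2)%:E * mu (D `&` X))%E.
  (* Only the cells that meet [G] are kept, since the density bound is known around points of [G]
     alone. *)
  pose F u := exists z, [/\ G z, (D `&` X) z & lab (maxn i i0) z = u].
  apply: (@measure_le_of_cover _ _ _ mu I F
    (fun u => [set z | lab (maxn i i0) z = u])
    (fun u => G `&` [set z | lab (maxn i i0) z = u])) => //.
  - by move=> u _; apply: measurableI.
  - exact: measurableI.
  - by move=> u v _ _ [z [/= <- <-]].
  - by move=> z [Gz DXz]; exists (lab (maxn i i0) z) => //; exists z.
  - move=> u [z [Gz DXz <-]].
    rewrite (_ : (D `&` X) `&` _ = cell (maxn i i0) z).
      exact/dG/leq_maxr.
    by apply/seteqP; split => [z' []//|z' zz']; split => //; exact: sDX DXz.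
(* The right-hand side is [7 g / 8], which contradicts [0 < g]. *)
have : (g%:E <= (1/2 * (g + g / 4) + g / 4)%:E)%E.
  rewrite -gE; apply: le_trans h1 _; rewrite EFinD; apply: leeD2r.
  apply: le_trans h3 _; rewrite (EFinM (1 / 2) (g + _)).
  apply: lee_wpmul2l; first by rewrite lee_fin; lra.
  by rewrite EFinD -gE.
by rewrite lee_fin; lra.
Qed.

(** In the application [m i] is the measure of a cell, [sh i] moves points back in time by a whole
    number of cells, [P i z] is the later part of the rectangle attached to the cell of [z], [c i z]
    is its near-optimal constant, and [Dst i u] is a dilate of the cell [u] forward in time that
    undoes the shifts. The constant [C] controls both the dilates and the ratio of consecutive cell
    measures. *)
Context (m : nat -> R) (C s0 : R) (S0 : set T) (sh : nat -> T -> T).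
Context (Dst : nat -> I -> set T) (P : nat -> T -> set T).
Context (c : nat -> T -> R) (f : T -> R).

Hypothesis mf : measurable_fun setT f.
Hypothesis m_gt0 : forall i, 0 < m i.
Hypothesis mu_cell : forall i z, mu (cell i z) = (m i)%:E.
Hypothesis C_ge1 : 1 <= C.
Hypothesis m_doubling : forall i, m i <= C * m i.+1.
Hypothesis s0_ge0 : 0 <= s0.
Hypothesis S0_fin : (mu S0 < +oo)%E.
Hypothesis S0_sat : saturated 1 S0.
Hypothesis c_lab : forall i z z', lab i z = lab i z' -> c i z = c i z'.
Hypothesis mP : forall i z, measurable (P i z).
Hypothesis mDst : forall i u, measurable (Dst i u).
Hypothesis mu_Dst : forall i u, (mu (Dst i u) <= (C * m i)%:E)%E.
Hypothesis Dst_cover : forall i j z z', (0 < i <= j)%N -> S0 z -> S0 z' ->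
  lab i (sh j z) = lab i (sh i z') -> Dst i (lab i (sh i z')) z.
Hypothesis cell_P : forall i z, (0 < i)%N -> S0 z -> cell i z `<=` P i z.
Hypothesis shift_P : forall i j z z', (0 < i < j)%N -> S0 z -> lab i z' = lab i z ->
  cell j (sh j z') `<=` P i z.
Hypothesis c_upper : forall i z, (0 < i)%N -> S0 z ->
  (mu (P i z `&` [set w | (c i z + s0 < f w)%R]) <= ((4 * C)^-1 * m i)%:E)%E.
Hypothesis c_lower : forall i z, (0 < i)%N -> S0 z ->
  (mu (cell i (sh i z) `&` [set w | (f w < c i z - s0)%R]) <= (4^-1 * m i)%:E)%E.

Let mcell := measurable_cell.
Let m_ge0 i : 0 <= m i. Proof. exact: ltW. Qed.
Let C_gt0 : 0 < C. Proof. exact: lt_le_trans C_ge1. Qed.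
Let mlevel a : measurable [set z | a < f z]. Proof. exact: measurable_level. Qed.

(* The cells [cell i (sh i z)] attached to the points of the superlevel set lie
   in [PX] and [f] is large on half of each; among them the maximal ones are
   disjoint, and their dilates [Dst] still cover. *)
Lemma superlevel_cover i0 (X PX : set T) a : (0 < i0)%N -> X `<=` S0 ->
  saturated i0 X -> measurable PX ->
  (forall j z, (i0 <= j)%N -> X z -> cell j (sh j z) `<=` PX) ->
  (mu [set z | X z /\ exists2 j, (i0 <= j)%N & (a < c j z)%R]
    <= (2 * C)%:E * mu (PX `&` [set z | (a - s0 < f z)%R]))%E.
Proof.
move=> i00 XS sX mPX XP.
pose bad j z := [/\ (i0 <= j)%N, X z & a < c j z].
have mE : measurable [set z | X z /\ exists2 j, (i0 <= j)%N & a < c j z].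
  rewrite (_ : mkset _ = \bigcup_j [set z | bad j z]); last first.
    by apply/seteqP; split => [z [Xz [j ij ac]]|z [j _ [? ? ?]]];
      [exists j|split => //; exists j].
  apply: bigcupT_measurable => j; have [ij|ij] := leqP i0 j; last first.
    rewrite (_ : mkset _ = set0)//; apply/seteqP; split => // z [].
    by rewrite leqNgt ij.
  apply: (@measurable_saturated j) => z z' zz' [_ Xz ac]; split => //.
    exact: (saturated_le ij sX) Xz.
  by rewrite -(c_lab zz').
(* Selects the shifted cells of bad points that lie in no shifted cell of a bad point of an earlier
   generation. By nestedness, two that meet have the same generation and then coincide. *)
pose F (iu : nat * I) := exists z, [/\ bad iu.1 z, iu.2 = lab iu.1 (sh iu.1 z) &
  forall k z', (k < iu.1)%N -> bad k z' -> lab k (sh k z') <> lab k (sh iu.1 z)].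
pose Q (iu : nat * I) := [set z | lab iu.1 z = iu.2].
have mQ j z : measurable (cell j z `&` [set w | a - s0 < f w]) by exact: measurableI.
apply: (@measure_le_of_cover _ _ _ mu (nat * I)%type F Q
  (fun iu => Dst iu.1 iu.2)) => //.
- by move=> j _; exact: mlab.
- exact: measurableI.
- have wlog_lt j u k v z : (k < j)%N -> F (j, u) -> F (k, v) -> lab j z = u ->
      lab k z = v -> False.
    move=> kj [zj [_ /= -> hj]] [zk [bk /= -> _]] zzj zzk.
    apply: (hj _ _ kj bk); rewrite -zzk; apply: lab_le zzj; exact: ltnW.
  move=> [j u] [k v] Fj Fk [z []]; rewrite /Q /= => zj zk.
  case: (ltngtP j k) => [jk|kj|jk].
  + by case: (wlog_lt _ _ _ _ _ jk Fk Fj zk zj).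
  + by case: (wlog_lt _ _ _ _ _ kj Fj Fk zj zk).
  + by rewrite -zj -zk jk.
- move=> z [Xz [j ij ac]].
  (* The least such [k] gives the maximal shifted cell around [sh j z], whose dilate contains
     [z]. *)
  have exk : exists k, `[< (k <= j)%N /\
      exists z', bad k z' /\ lab k (sh k z') = lab k (sh j z) >].
    by exists j; apply/asboolP; split => //; exists z.
  case: (ex_minnP exk) => k /asboolP[kj [z' [bk kz]]] kmin.
  exists (k, lab k (sh k z')) => /=; last first.
    case: bk => ik Xz' _.
    apply: (Dst_cover (j := j)) => //; [|exact: XS|exact: XS].
    by rewrite kj andbT (leq_trans i00).
  exists z'; split => //= k' z'' kk' bk' h; suff : (k <= k')%N by rewrite leqNgt kk'.
  apply: kmin; apply/asboolP; split; first exact: leq_trans (ltnW kk') kj.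
  by exists z''; split => //; rewrite h; apply: (lab_le (ltnW kk')).
- by rewrite mulr_ge0 ?ltW// ltW.
- move=> [j _] [z [[/= ij Xz ac] /= -> _]]; rewrite /Q /=.
  have j0 : (0 < j)%N by exact: leq_trans ij.
  set D := cell j (sh j z).
  (* By [c_lower] at most a quarter of the shifted cell has [f < c j z - s0]; on the rest [f]
     exceeds [a - s0]. *)
  have hD : ((m j)%:E <= mu (D `&` [set w | (a - s0 < f w)%R]) + (4^-1 * m j)%:E)%E.
    rewrite -(mu_cell j (sh j z)).
    apply: le_trans (leeD2l _ (c_lower j0 (XS _ Xz))).
    apply: le_trans (measureU2 mu (mQ _ _) _); last first.
      by apply: measurableI => //; exact: measurable_lt_level.
    apply: measure_mono => //.
      apply: measurableU => //.
      by apply: measurableI => //; exact: measurable_lt_level.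
    move=> w Dw; have [fw|fw] := ltP (f w) (c j z - s0); first by right.
    by left; split => //=; apply: lt_le_trans fw; rewrite ltrD2r.
  rewrite (_ : _ `&` _ `&` _ = D `&` [set w | a - s0 < f w]); last first.
    apply/seteqP; split => [w [[? ?] ?]//|w [Dw ?]]; split => //; split => //.
    exact: XP Dw.
  apply: le_trans (mu_Dst _ _) _.
  have Doo : mu (D `&` [set w | (a - s0 < f w)%R]) \is a fin_num.
    rewrite ge0_fin_numE//; apply: (@le_lt_trans _ _ (mu D)).
      by apply: measure_mono => [||w []//]; [exact: mQ|exact: mcell].
    by rewrite mu_cell ltry.
  have [x xE] : exists x, mu (D `&` [set w | (a - s0 < f w)%R]) = x%:E.
    by exists (fine (mu (D `&` [set w | a - s0 < f w]))); rewrite fineK.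
  move: hD; rewrite xE -EFinD -EFinM !lee_fin => hD.
  rewrite (mulrC 2) -mulrA ler_pM2l//; have := m_gt0 j; lra.
Qed.

(** If [c i0 z - s0] exceeded [cX + s0], every point of the shifted cell would violate the upper
    bound by [cX] or the lower bound by [c i0 z], but each fails on at most a quarter of a cell. *)
Lemma c_step cX i0 (X PX : set T) z : (0 < i0)%N -> X `<=` S0 ->
  measurable PX -> X z -> cell i0 (sh i0 z) `<=` PX ->
  (mu (PX `&` [set w | (cX + s0 < f w)%R]) <= (4^-1 * m i0)%:E)%E ->
  c i0 z <= cX + 2 * s0.
Proof.
move=> i00 XS mPX Xz XP hX; rewrite leNgt; apply/negP => cc.
set D := cell i0 (sh i0 z); have mD : measurable D by exact: mcell.
have : (mu D <= (4^-1 * m i0)%:E + (4^-1 * m i0)%:E)%E.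
  apply: le_trans (leeD hX (c_lower i00 (XS _ Xz))).
  have m1 : measurable (PX `&` [set w | (cX + s0 < f w)%R]) by exact: measurableI.
  have m2 : measurable (D `&` [set w | f w < c i0 z - s0]).
    by apply: measurableI => //; exact: measurable_lt_level.
  apply: le_trans (measureU2 mu m1 m2).
  apply: measure_mono => //; first exact: measurableU.
  move=> w Dw; have [fw|fw] := ltP (f w) (c i0 z - s0); first by right.
  by left; split; [exact: XP|rewrite /=; lra].
by rewrite mu_cell -EFinD lee_fin; have := m_gt0 i0; lra.
Qed.

(** Stop where the constant first exceeds [a = cX + 2 * s0]. The stopped cells have small union by
    [superlevel_cover], each inherits the decay with factor [th], and outside them the superlevel
    set is null. A general [X] covers both the descendants of a cell and the root. *)
Lemma superlevel_step i0 (X PX : set T) cX s th : (0 < i0)%N -> X `<=` S0 ->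
  saturated i0 X -> measurable PX ->
  (forall j z, (i0 <= j)%N -> X z -> cell j (sh j z) `<=` PX) ->
  (mu (PX `&` [set w | (cX + s0 < f w)%R]) <= (4^-1 * m i0)%:E)%E ->
  s0 <= s -> 0 <= th ->
  (forall j z, (0 < j)%N -> S0 z ->
    mu (cell j z `&` [set w | (c j z + s < f w)%R]) <= (th * m j)%:E)%E ->
  (mu (X `&` [set w | (cX + s + 4 * s0 < f w)%R])
    <= (th * (2 * C))%:E * mu (PX `&` [set w | (cX + s0 < f w)%R]))%E.
Proof.
move=> i00 XS sX mPX XP hX s0s th0 hth.
set a := cX + 2 * s0.
set E := [set z | X z /\ exists2 j, (i0 <= j)%N & a < c j z].
have hE : (mu E <= (2 * C)%:E * mu (PX `&` [set w | (cX + s0 < f w)%R]))%E.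
  rewrite (_ : cX + s0 = a - s0); last by rewrite /a; lra.
  exact: superlevel_cover XP.
have mX := measurable_saturated sX.
(* Stopping time: [j] is the first generation from [i0] on whose constant exceeds [a]. It depends
   only on the label at generation [j], as this determines the earlier ones. *)
pose first j z := [/\ (i0 <= j)%N, X z, a < c j z &
  forall k, (i0 <= k < j)%N -> c k z <= a].
have first_lab j z z' : lab j z = lab j z' -> first j z -> first j z'.
  move=> zz' [ij Xz ac hk]; split => //.
  - exact: (saturated_le ij sX) Xz.
  - by rewrite -(c_lab zz').
  - move=> k /andP[ik kj]; rewrite -(c_lab (lab_le (ltnW kj) zz')).
    by apply: hk; rewrite ik.
have mfirst j : measurable [set z | first j z].
  exact: (@measurable_saturated j _ (first_lab j)).
have EE : E = \bigcup_j [set z | first j z].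
  apply/seteqP; split => [z [Xz [j ij ac]]|z [j _ [ij Xz ac _]]]; last first.
    by split => //; exists j.
  have exk : exists k, (i0 <= k)%N && (a < c k z) by exists j; rewrite ij.
  case: (ex_minnP exk) => k /andP[ik ak] kmin; exists k => //; split => //.
  move=> l /andP[il lk]; rewrite leNgt; apply/negP => al.
  by have := kmin l; rewrite il al leqNgt lk => /(_ isT).
have mE : measurable E by rewrite EE; exact: bigcupT_measurable.
set Y := [set w | cX + s + 4 * s0 < f w].
have mY : measurable Y by exact: mlevel.
have mG : measurable ((X `\` E) `&` Y).
  by apply: measurableI => //; exact: measurableD.
(* The constant cannot overshoot much: at [i0] it is compared with [cX], and later with the parent
   cell, which was not stopped and so has a constant at most [a]. *)
have first_c j z : first j z -> c j z <= a + 2 * s0.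
  move=> [ij Xz ac hk]; move: ij; rewrite leq_eqVlt => /orP[/eqP ij|ij].
    have : c j z <= cX + 2 * s0.
      by apply: (c_step _ XS mPX Xz) => //; rewrite -ij//; exact: XP.
    by rewrite /a; have := s0_ge0; lra.
  case: j ij ac hk => // j; rewrite ltnS => ij ac hk.
  have j0 : (0 < j)%N by exact: leq_trans ij.
  apply: (@le_trans _ _ (c j z + 2 * s0)); last first.
    by rewrite lerD2r; apply: hk; rewrite ij/=.
  apply: (@c_step _ j.+1 (cell j z) (P j z)) => //.
  - by move=> w wz; apply: (saturated_le j0 S0_sat) (XS _ Xz).
  - by apply: shift_P => //; [rewrite j0/=|exact: XS].
  - apply: le_trans (c_upper j0 (XS _ Xz)) _; rewrite lee_fin.
    rewrite invfM -mulrA ler_pM2l ?invr_gt0//.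
    by rewrite ler_pdivrMl//; exact: m_doubling.
(* Off [E] all constants stay at most [a], so [Y] lies above [c j z + s0], and [c_upper] leaves it a
   proportion at most [1/(4C)], hence at most one half, of each cell. *)
have G0 : mu ((X `\` E) `&` Y) = 0%E.
  apply: (@null_of_half_density X _ i0) => //.
  - apply: le_lt_trans S0_fin; apply: measure_mono => //.
    exact: measurable_saturated S0_sat.
  - by move=> z [[]].
  - move=> z j [[Xz nE] Yz] ij.
    have j0 : (0 < j)%N by exact: leq_trans ij.
    have ca : c j z <= a.
      by rewrite leNgt; apply/negP => ca; apply: nE; split => //; exists j.
    apply: (@le_trans _ _ (mu (P j z `&` [set w | (c j z + s0 < f w)%R]))).
      apply: measure_mono.
      - by apply: measurableI => //; exact: mcell.
      - exact: measurableI.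
      - move=> w [[_ Yw] zw]; split; first by apply: cell_P => //; exact: XS.
        move: Yw; rewrite /Y /= /a in ca *; have := s0_ge0; lra.
    apply: le_trans (c_upper j0 (XS _ Xz)) _.
    rewrite mu_cell -EFinM lee_fin ler_wpM2r// div1r.
    by rewrite lef_pV2 ?posrE//; have := C_ge1; lra.
(* The stopped cells are disjoint with union [E]; by [first_c] the level of [Y] is at least [s]
   above each of their constants. *)
have hEY : (mu (E `&` Y) <= th%:E * mu E)%E.
  pose F (ju : nat * I) := exists2 z, first ju.1 z & lab ju.1 z = ju.2.
  apply: (@measure_le_of_cover _ _ _ mu (nat * I)%type F
    (fun ju => [set z | lab ju.1 z = ju.2])
    (fun ju => [set z | lab ju.1 z = ju.2] `&` Y)) => //.
  - by move=> ju _; apply: measurableI.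
  - exact: measurableI.
  - have wlog_lt j k z : (k < j)%N -> first j z -> first k z -> False.
      move=> kj [_ _ _ hj] [ik _ ak _].
      by have := hj k; rewrite ik kj leNgt ak => /(_ isT).
    move=> [j u] [k v] [zj fj /= zju] [zk fk /= zkv] [z [/= zu zv]].
    have {}fj : first j z by apply: first_lab fj; rewrite zu.
    have {}fk : first k z by apply: first_lab fk; rewrite zv.
    case: (ltngtP j k) => [jk|kj|jk].
    + by case: (wlog_lt _ _ _ jk fk fj).
    + by case: (wlog_lt _ _ _ kj fj fk).
    + by rewrite -zu -zv jk.
  - move=> z []; rewrite {1}EE => -[j _ fj] Yz; exists (j, lab j z) => //.
    by exists z.
  - move=> [j u] [z /= fz <-].
    have [ij Xz _ _] := fz.
    rewrite (_ : E `&` _ = cell j z); last first.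
      apply/seteqP; split => [w []//|w wz]; split => //.
      by rewrite EE; exists j => //; apply: first_lab fz; rewrite wz.
    rewrite mu_cell -EFinM.
    apply: le_trans (hth j z (leq_trans i00 ij) (XS _ Xz)).
    apply: measure_mono; [exact: measurableI|exact: measurableI|].
    move=> w [zw Yw]; split => //; move: Yw; rewrite /Y /=.
    by have := first_c _ _ fz; rewrite /a; lra.
apply: (@le_trans _ _ (mu (E `&` Y) + mu ((X `\` E) `&` Y)))%E.
  have m1 : measurable (E `&` Y) by exact: measurableI.
  apply: le_trans (measureU2 mu m1 mG).
  apply: measure_mono; [exact: measurableI|exact: measurableU|].
  move=> w [Xw Yw]; have [Ew|nEw] := pselect (E w); first by left.
  by right.
rewrite G0 adde0; apply: le_trans hEY _; rewrite EFinM -muleA.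
by apply: lee_wpmul2l; rewrite ?lee_fin.
Qed.

(** Induction through the descendants of the cell: the factor [2C] of the covering meets the
    proportion [1/(4C)] of [c_upper], so raising the level by [4 * s0] gains exactly one half. *)
Lemma cell_decay k i z : (0 < i)%N -> S0 z ->
  (mu (cell i z `&` [set w | (c i z + (s0 + k%:R * (4 * s0)) < f w)%R])
    <= (2^-1 ^+ k * m i)%:E)%E.
Proof.
elim: k i z => [|k IH] i z i0 Sz.
  rewrite expr0 mul1r -(mu_cell i z); apply: measure_mono => //.
  exact: measurableI.
set s := s0 + k%:R * (4 * s0).
have s0s : s0 <= s by rewrite lerDl !mulr_ge0.
rewrite (_ : c i z + _ = c i z + s + 4 * s0); last by rewrite /s -natr1; lra.
have sat : saturated i.+1 (cell i z).
  by move=> w w' /lab_refine ww' wz; rewrite /cell /= -ww'.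
have cS : cell i z `<=` S0.
  by move=> w wz; apply: (saturated_le i0 S0_sat) Sz.
have hP j w : (i.+1 <= j)%N -> cell i z w -> cell j (sh j w) `<=` P i z.
  by move=> ij zw; apply: shift_P; rewrite ?i0.
have hX : (mu (P i z `&` [set w | (c i z + s0 < f w)%R]) <= (4^-1 * m i.+1)%:E)%E.
  apply: le_trans (c_upper i0 Sz) _; rewrite lee_fin.
  rewrite invfM -mulrA ler_pM2l ?invr_gt0//.
  by rewrite ler_pdivrMl//; exact: m_doubling.
apply: le_trans (superlevel_step (ltn0Sn i) cS sat (mP i z) hP hX s0s _ IH) _.
  by rewrite exprn_ge0.
apply: (@le_trans _ _ ((2^-1 ^+ k * (2 * C))%:E * ((4 * C)^-1 * m i)%:E))%E.
  apply: lee_wpmul2l; last exact: c_upper.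
  by rewrite lee_fin !mulr_ge0// ltW.
rewrite -EFinM lee_fin exprS; set x := 2^-1 ^+ k.
by rewrite le_eqVlt; apply/orP; left; apply/eqP; field; rewrite gt_eqF.
Qed.

(** At the first generation the superlevel set in [P0] is kept instead of being bounded by a cell,
    so that Chebyshev's inequality can later produce the integral of the theorem. *)
Lemma root_decay c0 (P0 : set T) k : measurable P0 ->
  (forall j z, (0 < j)%N -> S0 z -> cell j (sh j z) `<=` P0) ->
  (mu (P0 `&` [set w | (c0 + s0 < f w)%R]) <= (4^-1 * m 1)%:E)%E ->
  (mu (S0 `&` [set w | (c0 + (s0 + k.+1%:R * (4 * s0)) < f w)%R])
    <= (2^-1 ^+ k * (2 * C))%:E * mu (P0 `&` [set w | (c0 + s0 < f w)%R]))%E.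
Proof.
move=> mP0 hP0 h0.
rewrite (_ : c0 + _ = c0 + (s0 + k%:R * (4 * s0)) + 4 * s0); last first.
  by rewrite -natr1; lra.
apply: (@superlevel_step 1) => //.
- by rewrite lerDl !mulr_ge0.
- by move=> j z j0 Sz; exact: cell_decay.
Qed.

End stopping.

(** * Lebesgue measure on spacetime *)

Lemma measurable_box (R : realType) n (A : 'I_n -> set (measurableTypeR R)) :
  (forall i, measurable (A i)) ->
  measurable [set x : 'rV[R]_n | forall i, A i (x ord0 i)].
Proof.
move=> mA.
rewrite (_ : mkset _ = \bigcap_(i in [set: 'I_n])
    ((fun x : 'rV[R]_n => x ord0 i : measurableTypeR R) @^-1` A i)); last first.
  by apply/seteqP; split => x /= h i; [move=> _|]; apply: h.
apply: fin_bigcap_measurable => // i _; rewrite -[X in measurable X]setTI.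
by apply: measurable_coord_rV.
Qed.

Lemma cons_rV_head (R : realType) n (z : 'rV[R]_n * measurableTypeR R) :
  cons_rV z ord0 ord0 = z.2.
Proof.
have := row_mxEl (z.2%:M : 'rV[R]_1) z.1 ord0 ord0.
by rewrite lshift0 => h; apply: etrans h _; rewrite mxE eqxx mulr1n.
Qed.

Lemma cons_rV_tail (R : realType) n (z : 'rV[R]_n * measurableTypeR R) j :
  cons_rV z ord0 (lift ord0 j) = z.1 ord0 j.
Proof. by have := row_mxEr (z.2%:M : 'rV[R]_1) z.1 ord0 j; rewrite rshift1. Qed.

Lemma lebesgue_rV_box (R : realType) n (A : 'I_n -> set (measurableTypeR R)) (h : R) :
  (forall i, measurable (A i)) -> (forall i, lebesgue_measure (A i) = h%:E) ->
  lebesgue_rV n [set x | forall i, A i (x ord0 i)] = (h ^+ n)%:E.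
Proof.
elim: n A => [|n IH] A mA hA.
  rewrite /lebesgue_rV /= /dirac indicE mem_set /=; first by rewrite expr0.
  by move=> [].
rewrite /lebesgue_rV -/lebesgue_rV /= /lebesgue_rV_step /pushforward.
rewrite (_ : _ @^-1` _ = [set x : 'rV[R]_n | forall i, A (lift ord0 i) (x ord0 i)]
    `*` A ord0); last first.
  apply/seteqP; split => [[x s] /= xA|[x s] /= [xA xA0] i].
    split => [i|]; first by have := xA (lift ord0 i); rewrite cons_rV_tail.
    by have := xA ord0; rewrite cons_rV_head.
  by case: (unliftP ord0 i) => [j ->|->]; rewrite ?cons_rV_tail ?cons_rV_head.
rewrite product_measure1E//; last first.
  exact: (measurable_box (A := fun i => A (lift ord0 i))).
rewrite exprSr EFinM; congr (_ * _)%E; last exact: hA.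
exact: (IH (fun i => A (lift ord0 i))).
Qed.

Lemma measurable_spacetime (R : realType) n (A : set ('rV[R]_n * measurableTypeR R)) :
  measurable A -> measurable (A : set (spacetime R n)).
Proof. by move=> mA; apply: sub_caratheodory; exact: sub_sigma_algebra. Qed.

Lemma lebesgue_spacetime_prod (R : realType) n (A : set 'rV[R]_n)
    (B : set (measurableTypeR R)) :
  measurable A -> measurable B ->
  lebesgue_spacetime (A `*` B) = (lebesgue_rV n A * lebesgue_measure B)%E.
Proof.
move=> mA mB; rewrite /lebesgue_spacetime /completed_measure_extension.
rewrite measurable_mu_extE; last exact: measurableX.
by rewrite -product_measure1E.
Qed.

(** The tails of the union decrease to the empty set inside [X], which has finite measure, so
    continuity from above applies. *)
Lemma measure_diff_bigcup_small d (T : measurableType d) (R : realType)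
    (mu : {measure set T -> \bar R}) (X : set T) (F : nat -> set T) (e : R) :
  measurable X -> (mu X < +oo)%E -> (forall k, measurable (F k)) -> 0 < e ->
  exists N, (mu (X `&` ((\bigcup_k F k) `\` \bigcup_(k in `I_N) F k)) <= e%:E)%E.
Proof.
move=> mX Xoo mF e0.
pose G N := X `&` ((\bigcup_k F k) `\` \bigcup_(k in `I_N) F k).
have mG N : measurable (G N).
  apply: measurableI => //; apply: measurableD; first exact: bigcupT_measurable.
  by apply: bigcup_measurable => k _.
have GX N : (mu (G N) <= mu X)%E by apply: le_measure; rewrite ?inE// => z [].
have G0 : \bigcap_N G N = set0.
  apply/seteqP; split => // z Gz; have [_ [[k _ Fz] _]] := Gz 0%N I.
  have [_ [_ nF]] := Gz k.+1 I; apply: nF.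
  by exists k => //=.
have cv : (mu \o G) N @[N --> \oo] --> 0%E.
  rewrite -(measure0 mu) -G0; apply: nonincreasing_cvg_mu => //.
  - exact: le_lt_trans (GX _) Xoo.
  - exact: bigcapT_measurable.
  - move=> i j ij; apply/subsetPset => z [Xz [Fz nF]]; split => //; split => //.
    by move=> [k /= ki Fk]; apply: nF; exists k => //=; exact: leq_trans ij.
move/fine_cvgP : cv => [_ /cvgr_lt/(_ e e0)[N _ hN]]; exists N.
have := hN N (leqnn N); rewrite /= -lte_fin fineK; first exact: ltW.
by rewrite ge0_fin_numE//; exact: le_lt_trans (GX _) Xoo.
Qed.

(** * Approximation of measurable sets by unions of cells *)

Definition saturated_sets (T I : Type) (lab : nat -> T -> I) : set (set T) :=
  [set D | exists i, saturated lab i D].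

Section approximation.
Context d (T : measurableType d) (R : realType) (mu : {measure set T -> \bar R}).
Context (I : countType) (lab : nat -> T -> I).
Hypothesis mlab : forall i u, measurable [set z | lab i z = u].
Hypothesis lab_refine : forall i z z', lab i.+1 z = lab i.+1 z' -> lab i z = lab i z'.

Definition approximable (X A : set T) := forall e : R, 0 < e ->
  exists i D, saturated lab i D /\
    (mu (X `&` ((A `\` D) `|` (D `\` A))) <= e%:E)%E.

Variable X : set T.
Hypothesis mX : measurable X.
Hypothesis Xoo : (mu X < +oo)%E.

Let msat i D := measurable_saturated mlab (D := D) (i := i).

Lemma approximableU A B : measurable A -> measurable B ->
  approximable X A -> approximable X B -> approximable X (A `|` B).
Proof.
move=> mA mB aA aB e e0; have e2 : 0 < e / 2 by rewrite divr_gt0.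
have [i [D [sD hD]]] := aA _ e2; have [j [E [sE hE]]] := aB _ e2.
have mD := msat sD; have mE := msat sE.
exists (maxn i j), (D `|` E); split.
  move=> z z' zz' [Dz|Ez]; [left|right].
    exact: (saturated_le lab_refine (leq_maxl i j) sD) Dz.
  exact: (saturated_le lab_refine (leq_maxr i j) sE) Ez.
have mm U V : measurable U -> measurable V ->
    measurable (X `&` ((U `\` V) `|` (V `\` U))).
  by move=> mU mV; apply: measurableI => //; apply: measurableU; exact: measurableD.
rewrite (splitr e) EFinD; apply: le_trans (leeD hD hE).
apply: le_trans (measureU2 mu (mm _ _ mA mD) (mm _ _ mB mE)).
apply: le_measure; rewrite ?inE.
- by apply: mm; exact: measurableU.
- by apply: measurableU; exact: mm.
- move=> z [Xz [[[Az|Bz] nDE]|[[Dz|Ez] nAB]]].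
  + by left; split => //; left; split => // ?; apply: nDE; left.
  + by right; split => //; left; split => // ?; apply: nDE; right.
  + by left; split => //; right; split => // ?; apply: nAB; left.
  + by right; split => //; right; split => // ?; apply: nAB; right.
Qed.

(** A countable union is first cut to a finite one, at the cost of [e / 2], because finitely many
    unions of cells have a common generation. *)
Lemma sigma_algebra_approximable :
  sigma_algebra setT [set A | measurable A /\ approximable X A].
Proof.
split.
- split=> // e e0; exists 0%N, set0; split => //.
  by rewrite !setD0 setU0 setI0 measure0 lee_fin ltW.
- move=> A [mA aA]; split; first exact: measurableD.
  move=> e /aA[i [D [sD hD]]]; exists i, (~` D); split.
    by move=> z z' zz' nDz Dz'; apply: nDz; apply: sD Dz'.
  have CD U V : ~` U `\` ~` V = V `\` U :> set T by rewrite setDE setCK setIC -setDE.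
  by rewrite setTD !CD setUC.
- move=> F hF; have mF k : measurable (F k) by have [] := hF k.
  split; first exact: bigcupT_measurable.
  move=> e e0; have e2 : 0 < e / 2 by rewrite divr_gt0.
  have [N hN] := measure_diff_bigcup_small mX Xoo mF e2.
  set FN := \bigcup_(k in `I_N) F k.
  have [mFN aFN] : measurable FN /\ approximable X FN.
    rewrite /FN bigcup_mkord; elim/big_ind : _ => //.
    + split=> // e' e'0; exists 0%N, set0; split => //.
      by rewrite !setD0 setU0 setI0 measure0 lee_fin ltW.
    + move=> A B [mA aA] [mB aB]; split; first exact: measurableU.
      exact: approximableU.
    + by move=> k _; have [] := hF k.
  have [i [D [sD hD]]] := aFN _ e2; have mD := msat sD.
  have mU : measurable (\bigcup_k F k) by exact: bigcupT_measurable.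
  exists i, D; split => //; rewrite (splitr e) EFinD; apply: le_trans (leeD hN hD).
  have m1 : measurable (X `&` (\bigcup_k F k `\` FN)).
    by apply: measurableI => //; exact: measurableD.
  have m2 : measurable (X `&` (FN `\` D `|` D `\` FN)).
    by apply: measurableI => //; apply: measurableU; exact: measurableD.
  apply: le_trans (measureU2 mu m1 m2); apply: le_measure; rewrite ?inE.
  + by apply: measurableI => //; apply: measurableU; exact: measurableD.
  + exact: measurableU.
  + move=> z [Xz [[Fz nDz]|[Dz nFz]]].
      have [FNz|nFNz] := pselect (FN z); last by left.
      by right; split => //; left.
    right; split => //; right; split => // -[k _ Fkz]; apply: nFz.
    by exists k.
Qed.

Lemma sigma_sat_approximable A : <<s saturated_sets lab >> A ->
  measurable A /\ approximable X A.
Proof.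
suff h : <<s saturated_sets lab >> `<=` [set A | measurable A /\ approximable X A].
  exact: h.
apply: smallest_sub; first exact: sigma_algebra_approximable.
move=> D [i sD]; split; first exact: msat sD.
move=> e e0; exists i, D; split => //.
by rewrite !setDv setU0 setI0 measure0 lee_fin ltW.
Qed.

End approximation.

(** Sets open for the grid: collecting for each [i] the cells of generation [i] inside [A] exhibits
    [A] as a countable union of saturated sets. *)
Lemma saturated_sets_open (T : Type) (I : countType) (lab : nat -> T -> I) (A : set T) :
  (forall z, A z -> exists i, forall z', lab i z' = lab i z -> A z') ->
  <<s saturated_sets lab >> A.
Proof.
move=> hA.
rewrite (_ : A = \bigcup_i [set z | forall z', lab i z' = lab i z -> A z']); last first.
  by apply/seteqP; split => [z /hA[i iA]|z [i _ iA]]; [exists i|apply: iA].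
apply: sigma_algebra_bigcup => i; apply: sub_sigma_algebra; exists i.
by move=> z z' zz' zA z'' h; apply: zA; rewrite h zz'.
Qed.

(** When cells shrink to points, the half-spaces bounding a coordinate from above are open for the
    grid, so the identity is measurable from the sigma-algebra generated by saturated sets to the
    Borel one. *)
Lemma borel_saturated_sets (R : realType) n (I : countType)
    (lab : nat -> 'rV[R]_n * measurableTypeR R -> I) :
  (forall (i : 'I_n) (a : R) (z : 'rV[R]_n * measurableTypeR R), z.1 ord0 i < a ->
     exists k, forall z', lab k z' = lab k z -> z'.1 ord0 i < a) ->
  (forall (a : R) (z : 'rV[R]_n * measurableTypeR R), z.2 < a ->
     exists k, forall z', lab k z' = lab k z -> z'.2 < a) ->
  forall A : set ('rV[R]_n * measurableTypeR R), measurable A ->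
  <<s saturated_sets lab >> A.
Proof.
move=> h1 h2.
pose S := g_sigma_algebraType (saturated_sets lab).
have mh (g : S -> measurableTypeR R) :
    (forall a z, g z < a -> exists k, forall z', lab k z' = lab k z -> g z' < a) ->
    measurable_fun setT g.
  move=> hg; apply: (measurability _ (measurable_realfun.RGenInftyO.measurableE R)).
  move=> _ [_ [a ->] <-]; rewrite setTI; apply: saturated_sets_open => z /=.
  rewrite in_itv/= => /hg[k hk]; exists k => z' /hk; by rewrite in_itv.
have mid : measurable_fun setT (fun z : S => (z.1, z.2)).
  apply: measurable_fun_pair; last exact: mh.
  apply: measurable_fun_rV => i; apply: mh => a z /h1[k hk].
  by exists k.
move=> A mA; have := mid measurableT A mA; rewrite setTI.
by rewrite (_ : _ @^-1` _ = A)//; apply/seteqP; split => -[].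
Qed.

Lemma spacetime_approximable (R : realType) n (I : countType)
    (lab : nat -> 'rV[R]_n * measurableTypeR R -> I) :
  (forall i u, measurable ([set z | lab i z = u] : set (spacetime R n))) ->
  (forall i z z', lab i.+1 z = lab i.+1 z' -> lab i z = lab i z') ->
  (forall (i : 'I_n) (a : R) (z : 'rV[R]_n * measurableTypeR R), z.1 ord0 i < a ->
     exists k, forall z', lab k z' = lab k z -> z'.1 ord0 i < a) ->
  (forall (a : R) (z : 'rV[R]_n * measurableTypeR R), z.2 < a ->
     exists k, forall z', lab k z' = lab k z -> z'.2 < a) ->
  forall X G : set (spacetime R n), measurable X -> measurable G ->
  (lebesgue_spacetime X < +oo)%E ->
  approximable (@lebesgue_spacetime R n) lab X G.
Proof.
move=> mlab ref h1 h2 X G mX mG Xoo e e0; have e2 : 0 < e / 2 by rewrite divr_gt0.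
pose mu : {measure set (spacetime R n) -> \bar R} := @lebesgue_spacetime R n.
have mGX : measurable (X `&` G) by exact: measurableI.
have GXX : (mu (X `&` G) <= mu X)%E by apply: le_measure; rewrite ?inE.
have GXfin : mu (X `&` G) \is a fin_num.
  by rewrite ge0_fin_numE//; exact: le_lt_trans Xoo.
(* The completed measure is an infimum over countable Borel covers; a nearly optimal one has a Borel
   union [B], and [B] is approximated in place of [G]. *)
have [_ [F [mF GF] <-] hF] := lb_ereal_inf_adherent e2 GXfin.
set B := \bigcup_k F k.
have mB : measurable (B : set ('rV[R]_n * measurableTypeR R)).
  exact: bigcupT_measurable.
have mB' : measurable (B : set (spacetime R n)) by exact: measurable_spacetime.
have muB : (mu B <= mu (X `&` G) + (e / 2)%:E)%E.
  apply: le_trans (ltW hF).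
  apply: le_trans (measure_sigma_subadditive mu _ mB' (@subset_refl _ B)) _.
    by move=> k; exact: measurable_spacetime.
  apply: lee_nneseries => // k _.
  by rewrite (_ : mu (F k) = borel_spacetime (F k))//; exact: measurable_mu_extE.
have hB : (mu (B `\` (X `&` G)) <= (e / 2)%:E)%E.
  rewrite (measureD mB' mGX); first by rewrite (setIidr GF) leeBlDl// addeC.
  by apply: le_lt_trans muB _; rewrite -(fineK GXfin) -EFinD ltry.
have [i [D [sD hD]]] := (sigma_sat_approximable mlab ref mX Xoo
  (borel_saturated_sets h1 h2 mB)).2 _ e2.
have mD : measurable (D : set (spacetime R n)) by exact: (measurable_saturated mlab) sD.
exists i, D; split => //; rewrite (splitr e) EFinD; apply: le_trans (leeD hD hB).
have m1 : measurable (X `&` (B `\` D `|` D `\` B) : set (spacetime R n)).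
  by apply: measurableI => //; apply: measurableU; exact: measurableD.
have m2 : measurable (B `\` (X `&` G) : set (spacetime R n)) by exact: measurableD.
apply: le_trans (measureU2 mu m1 m2); apply: le_measure; rewrite ?inE.
- by apply: measurableI => //; apply: measurableU; exact: measurableD.
- exact: measurableU.
- move=> z [Xz [[Gz nDz]|[Dz nGz]]].
    by left; split => //; left; split => //; exact: GF.
  have [Bz|nBz] := pselect (B z); [right|left]; split => //; last by right.
  by move=> -[].
Qed.

(** * The parabolic grid *)

(** Makes the grids nested: the integer [N * floor y'] is below [N * y'], hence below
    [floor (N * y') = floor (N * y)], and dividing by [N] gives [floor y' <= y]. *)
Lemma floor_mul_nat (R : realType) (N : nat) (y y' : R) : (0 < N)%N ->
  Num.floor (N%:R * y) = Num.floor (N%:R * y') -> Num.floor y = Num.floor y'.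
Proof.
move=> N0; wlog le_fl : y y' / Num.floor y <= Num.floor y'.
  move=> H h; case: (leP (Num.floor y) (Num.floor y')) => [le|/ltW le].
    exact: H.
  by apply/esym/H.
move=> h; apply/eqP; rewrite eq_le le_fl /= floor_ge_int.
have N0' : 0 < N%:R :> R by rewrite ltr0n.
have : N%:Z * Num.floor y' <= Num.floor (N%:R * y).
  by rewrite h floor_ge_int intrM -pmulrn ler_pM2l// floor_le.
by rewrite floor_ge_int intrM -pmulrn ler_pM2l.
Qed.

Section scales.
Context (R : realType) (p al L : R) (m : nat).

Definition time_ratio : R := (2 ^+ m) `^ p.
Definition space_scale (i : nat) : nat := (2 ^ (m * i))%N.
(* [time_ratio ^+ i] is not an integer in general: it is replaced by a comparable
   power of two, so that the time grids are nested. *)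
Definition time_scale (i : nat) : nat :=
  (2 ^ (trunc_log 2 (Num.trunc (time_ratio ^+ i))).+2)%N.
Definition side i : R := L / (space_scale i)%:R.
Definition height i : R := side i `^ p.
(** Duration of a cell: the time interval of [R^+(al)] is cut into [time_scale i] equal slabs. It
    lies between a quarter and a half of [(1 - al) * height i]. *)
Definition tick i : R := (1 - al) * L `^ p / (time_scale i)%:R.

Hypothesis hp : 1 < p.
Hypothesis L0 : 0 < L.
Hypothesis al1 : al < 1.

Lemma space_scale_gt0 i : (0 < space_scale i)%N. Proof. by rewrite expn_gt0. Qed.
Lemma time_scale_gt0 i : (0 < time_scale i)%N. Proof. by rewrite expn_gt0. Qed.
Lemma space_scaleS i : space_scale i.+1 = (2 ^ m * space_scale i)%N.
Proof. by rewrite /space_scale mulnS expnD. Qed.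

Lemma time_ratio_ge : 2 ^+ m <= time_ratio.
Proof. by apply: le1r_powR; [rewrite exprn_ege1// ler1n|exact: ltW]. Qed.

Lemma time_ratio_ge1 : 1 <= time_ratio.
Proof. by apply: le_trans time_ratio_ge; rewrite exprn_ege1// ler1n. Qed.

Lemma time_ratio_gt0 : 0 < time_ratio. Proof. exact: lt_le_trans time_ratio_ge1. Qed.

Lemma time_scaleS i : exists2 N, (0 < N)%N & time_scale i.+1 = (N * time_scale i)%N.
Proof.
set e := trunc_log 2 (Num.trunc (time_ratio ^+ i)).
set e' := trunc_log 2 (Num.trunc (time_ratio ^+ i.+1)).
have ee : (e <= e')%N.
  apply: leq_trunc_log; apply: le_truncn.
  by rewrite exprS ler_peMl ?time_ratio_ge1// exprn_ge0// ltW// time_ratio_gt0.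
exists (2 ^ (e' - e))%N; first by rewrite expn_gt0.
by rewrite /time_scale -/e -/e' -expnD !addnS subnK.
Qed.

(** With [e] the logarithm in [time_scale] and [r = time_ratio ^+ i], one has [2^e <= r < 2^(e+1)],
    so [2^(e+2)] lies between [2 r] and [4 r]. *)
Lemma time_scale_le i : (time_scale i)%:R <= 4 * time_ratio ^+ i :> R.
Proof.
have r1 : 1 <= time_ratio ^+ i by rewrite exprn_ege1// time_ratio_ge1.
have t0 : (0 < Num.trunc (time_ratio ^+ i))%N by rewrite truncn_gt0.
rewrite /time_scale !expnS mulnA natrM; apply: ler_pM => //.
apply: le_trans (_ : (Num.trunc (time_ratio ^+ i))%:R <= _).
  by rewrite ler_nat trunc_logP.
by rewrite truncn_le (le_trans _ r1).
Qed.

Lemma time_scale_ge i : 2 * time_ratio ^+ i <= (time_scale i)%:R :> R.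
Proof.
have r1 : 1 <= time_ratio ^+ i by rewrite exprn_ege1// time_ratio_ge1.
rewrite /time_scale expnS natrM ler_pM2l//.
have /andP[_ /ltW h] := truncn_itv (le_trans ler01 r1).
apply: le_trans h _; rewrite ler_nat.
exact: trunc_log_ltn.
Qed.

Lemma heightE i : height i = L `^ p / time_ratio ^+ i.
Proof.
have bE : (space_scale i)%:R = (2 ^+ m) ^+ i :> R by rewrite /space_scale -exprM natrX.
rewrite /height /side bE; apply: (@mulIf _ (time_ratio ^+ i)).
  by rewrite expf_neq0// gt_eqF// time_ratio_gt0.
rewrite divfK; last by rewrite expf_neq0// gt_eqF// time_ratio_gt0.
have -> : time_ratio ^+ i = ((2 ^+ m) ^+ i) `^ p.
  elim: (i) => [|j IH]; first by rewrite !expr0 powR1.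
  by rewrite !exprS powRM ?exprn_ge0// IH.
have b0 : 0 < (2 ^+ m) ^+ i :> R by rewrite !exprn_gt0.
by rewrite -powRM ?divr_ge0 ?ltW// divfK// gt_eqF.
Qed.

Lemma side_gt0 i : 0 < side i.
Proof. by rewrite divr_gt0// ltr0n space_scale_gt0. Qed.

Lemma height_gt0 i : 0 < height i.
Proof. by rewrite powR_gt0// side_gt0. Qed.

Lemma tick_gt0 i : 0 < tick i.
Proof. by rewrite divr_gt0 ?ltr0n ?time_scale_gt0// mulr_gt0 ?powR_gt0// subr_gt0. Qed.

Lemma height0 : height 0 = L `^ p.
Proof. by rewrite heightE expr0 divr1. Qed.

Lemma height_le i j : (i <= j)%N -> height j <= height i.
Proof.
move=> ij; rewrite !heightE ler_pM2l ?powR_gt0//.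
rewrite lef_pV2 ?posrE ?exprn_gt0 ?time_ratio_gt0//.
by rewrite ler_weXn2l ?time_ratio_ge1.
Qed.

Lemma heightS i : height i.+1 = height i / time_ratio.
Proof. by rewrite !heightE exprSr invfM mulrA mulrAC. Qed.

(** What a large [m] buys: with [d = al - ga], the whole duration of a rectangle of a later
    generation fits into the time gap between the levels [ga] and [al]. *)
Lemma height_succ (d : R) i j : 2 <= d * time_ratio -> (i < j)%N ->
  2 * height j <= d * height i.
Proof.
move=> hd ij; apply: le_trans (_ : 2 * height i.+1 <= _).
  by rewrite ler_pM2l// height_le.
rewrite heightS mulrA ler_pdivrMr ?time_ratio_gt0// (mulrAC d).
by rewrite ler_wpM2r// ltW// height_gt0.
Qed.

Lemma tick_le i : 2 * tick i <= (1 - al) * height i.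
Proof.
rewrite heightE /tick mulrCA -!mulrA ler_pM2l ?subr_gt0// ler_pM2l ?powR_gt0//.
rewrite ler_pdivrMr ?ltr0n ?time_scale_gt0// mulrC.
rewrite ler_pdivlMr ?exprn_gt0 ?time_ratio_gt0//.
exact: time_scale_ge.
Qed.

Lemma tick_ge i : (1 - al) * height i <= 4 * tick i.
Proof.
rewrite heightE /tick [leRHS]mulrCA -!mulrA ler_pM2l ?subr_gt0// ler_pM2l ?powR_gt0//.
rewrite mulrC ler_pdivlMl ?ltr0n ?time_scale_gt0//.
rewrite ler_pdivrMr ?exprn_gt0 ?time_ratio_gt0//; exact: time_scale_le.
Qed.
End scales.

(** * Cubes, signed time and the two parts of a rectangle *)

Section cubes.
Context (R : realType) (n : nat).
Implicit Types (x y : 'rV[R]_n) (l : R).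

Definition half_open_cube x l : set 'rV[R]_n :=
  [set y | forall a, x ord0 a - l <= y ord0 a < x ord0 a + l].

Lemma sub_half_open_cube x l : half_open_cube x l `<=` cube x l.
Proof. by move=> y hy a; rewrite ler_distl; have /andP[-> /ltW] := hy a. Qed.

Lemma cubeE x l : cube x l =
  [set y | forall a, [set` `[x ord0 a - l, x ord0 a + l]] (y ord0 a)].
Proof. by apply/seteqP; split => y h a; have := h a; rewrite /= in_itv/= ler_distl. Qed.

Lemma half_open_cubeE x l : half_open_cube x l =
  [set y | forall a, [set` `[x ord0 a - l, x ord0 a + l[] (y ord0 a)].
Proof. by apply/seteqP; split => y h a; have := h a; rewrite /= in_itv. Qed.

Lemma measurable_cube x l : measurable (cube x l).
Proof.
rewrite cubeE.
apply: (@measurable_box R n (fun a => [set` `[x ord0 a - l, x ord0 a + l]])).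
by move=> a; exact: measurable_itv.
Qed.

Lemma measurable_half_open_cube x l : measurable (half_open_cube x l).
Proof.
rewrite half_open_cubeE.
apply: (@measurable_box R n (fun a => [set` `[x ord0 a - l, x ord0 a + l[])).
by move=> a; exact: measurable_itv.
Qed.

Lemma lebesgue_cube x l : 0 < l -> lebesgue_rV n (cube x l) = ((2 * l) ^+ n)%:E.
Proof.
move=> l0; rewrite cubeE.
apply: (@lebesgue_rV_box R n (fun a => [set` `[x ord0 a - l, x ord0 a + l]])).
  by move=> a; exact: measurable_itv.
move=> a; rewrite lebesgue_measure_itv/= lte_fin ifT; last lra.
by rewrite -EFinD; congr _%:E; lra.
Qed.

Lemma lebesgue_half_open_cube x l : 0 < l ->
  lebesgue_rV n (half_open_cube x l) = ((2 * l) ^+ n)%:E.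
Proof.
move=> l0; rewrite half_open_cubeE.
apply: (@lebesgue_rV_box R n (fun a => [set` `[x ord0 a - l, x ord0 a + l[])).
  by move=> a; exact: measurable_itv.
move=> a; rewrite lebesgue_measure_itv/= lte_fin ifT; last lra.
by rewrite -EFinD; congr _%:E; lra.
Qed.

End cubes.

Section signed_time.
Context (R : realType) (n : nat) (p t0 : R) (sg : bool).
Implicit Types (a b g t l : R) (x : 'rV[R]_n).

(* [sg = true] keeps the direction of time, [sg = false] reverses it around
   [t0]; the two estimates of the theorem are one statement in this time. *)
Definition stime (s : R) : R := if sg then s - t0 else t0 - s.
Definition of_stime (v : R) : R := if sg then t0 + v else t0 - v.

Lemma of_stimeK v : stime (of_stime v) = v.
Proof. by rewrite /stime /of_stime; case: sg; lra. Qed.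

(** In signed time the near part is the later one, where superlevel sets are estimated, and the far
    part is the earlier one, which supplies the lower bounds. *)
Definition near_part g x t l : set ('rV[R]_n * R) :=
  if sg then prect_upper p g x t l else prect_lower p g x t l.
Definition far_part g x t l : set ('rV[R]_n * R) :=
  if sg then prect_lower p g x t l else prect_upper p g x t l.

Definition oslab a b : set (measurableTypeR R) := [set s | a < stime s < b].
Definition slab a b : set (measurableTypeR R) := [set s | a <= stime s < b].

Lemma oslabE a b : oslab a b =
  if sg then [set` `]t0 + a, t0 + b[] else [set` `]t0 - b, t0 - a[].
Proof.
by rewrite /oslab /stime; case: sg; apply/seteqP; split => s /=; rewrite in_itv/=; lra.
Qed.

Lemma slabE a b : slab a b =
  if sg then [set` `[t0 + a, t0 + b[] else [set` `]t0 - b, t0 - a]].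
Proof.
by rewrite /slab /stime; case: sg; apply/seteqP; split => s /=; rewrite in_itv/=; lra.
Qed.

Lemma measurable_oslab a b : measurable (oslab a b).
Proof. by rewrite oslabE; case: sg; exact: measurable_itv. Qed.

Lemma measurable_slab a b : measurable (slab a b).
Proof. by rewrite slabE; case: sg; exact: measurable_itv. Qed.

Lemma lebesgue_oslab a b : a < b -> lebesgue_measure (oslab a b) = (b - a)%:E.
Proof.
move=> ab; rewrite oslabE; case: sg; rewrite lebesgue_measure_itv/= lte_fin.
  by rewrite ltrD2l ab -EFinD; congr _%:E; lra.
by rewrite ltrD2l ltrN2 ab -EFinD; congr _%:E; lra.
Qed.

Lemma lebesgue_slab a b : a < b -> lebesgue_measure (slab a b) = (b - a)%:E.
Proof.
move=> ab; rewrite slabE; case: sg; rewrite lebesgue_measure_itv/= lte_fin.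
  by rewrite ltrD2l ab -EFinD; congr _%:E; lra.
by rewrite ltrD2l ltrN2 ab -EFinD; congr _%:E; lra.
Qed.

(** Rectangles are described by their final signed time [T] instead of their centre, because a cell
    and its rectangle share their top. *)
Lemma near_partE g x T l : near_part g x (of_stime (T - l `^ p)) l =
  cube x l `*` oslab (T - (1 - g) * l `^ p) T.
Proof.
rewrite /near_part /prect_upper /prect_lower /of_stime /oslab /stime; case: sg;
  by apply/seteqP; split => -[y s] /= []; rewrite in_itv /= => hy hs; split => //; lra.
Qed.

Lemma far_partE g x T l : far_part g x (of_stime (T - l `^ p)) l =
  cube x l `*` oslab (T - 2 * l `^ p) (T - (1 + g) * l `^ p).
Proof.
rewrite /far_part /prect_upper /prect_lower /of_stime /oslab /stime; case: sg;
  by apply/seteqP; split => -[y s] /= []; rewrite in_itv /= => hy hs; split => //; lra.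
Qed.

Lemma prectE x T l : prect p x (of_stime (T - l `^ p)) l =
  cube x l `*` oslab (T - 2 * l `^ p) T.
Proof.
rewrite /prect /of_stime /oslab /stime; case: sg;
  by apply/seteqP; split => -[y s] /= []; rewrite in_itv /= => hy hs; split => //; lra.
Qed.

Lemma of_stime0 T : of_stime (T - T) = t0.
Proof. by rewrite subrr /of_stime addr0 subr0; case: sg. Qed.

End signed_time.

Section parts.
Context (R : realType) (n : nat) (p : R) (sg : bool).
Implicit Types (g t l : R) (x : 'rV[R]_n).

Lemma measurable_near_part g x t l :
  measurable (near_part p sg g x t l : set (spacetime R n)).
Proof.
rewrite -(of_stime0 t sg (l `^ p)) near_partE; apply: measurable_spacetime.
by apply: measurableX; [exact: measurable_cube|exact: measurable_oslab].
Qed.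

Lemma lebesgue_near_part g x t l : g < 1 -> 0 < l ->
  lebesgue_spacetime (near_part p sg g x t l) =
  ((2 * l) ^+ n * ((1 - g) * l `^ p))%:E.
Proof.
move=> g1 l0; rewrite -(of_stime0 t sg (l `^ p)) near_partE.
rewrite lebesgue_spacetime_prod; last first.
- exact: measurable_oslab.
- exact: measurable_cube.
have h : 0 < (1 - g) * l `^ p by rewrite mulr_gt0 ?subr_gt0// powR_gt0.
rewrite lebesgue_cube// lebesgue_oslab; last by lra.
by rewrite -EFinM; congr (_ * _)%:E; lra.
Qed.

Lemma near_part_sub g x t l : -1 < g -> 0 < l ->
  near_part p sg g x t l `<=` prect p x t l.
Proof.
move=> g1 l0; have lp : 0 < l `^ p by exact: powR_gt0.
have : 0 < (1 + g) * l `^ p by rewrite mulr_gt0//; lra.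
rewrite /near_part /prect_upper /prect_lower /prect.
case: sg => h [y s] [/= hy]; rewrite in_itv/= => hs; split => //=;
  rewrite in_itv/=; lra.
Qed.

End parts.

Lemma measurable_far_part (R : realType) n (p : R) sg g (x : 'rV[R]_n) t l :
  measurable (far_part p sg g x t l : set (spacetime R n)).
Proof. by have := measurable_near_part p (~~ sg) g x t l; case: sg. Qed.

Lemma lebesgue_far_part (R : realType) n (p : R) sg g (x : 'rV[R]_n) t l :
  g < 1 -> 0 < l -> lebesgue_spacetime (far_part p sg g x t l) =
  ((2 * l) ^+ n * ((1 - g) * l `^ p))%:E.
Proof.
by move=> g1 l0; have := lebesgue_near_part p (~~ sg) x t g1 l0; case: sg.
Qed.

(* Half-open in space and time, so as to be a union of grid cells. *)
Definition root_cell (R : realType) n (p t0 : R) sg (al : R) (x : 'rV[R]_n) (L : R) :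
    set ('rV[R]_n * measurableTypeR R) :=
  half_open_cube x L `*` slab t0 sg (al * L `^ p) (L `^ p).

Section root_cell.
Context (R : realType) (n : nat) (p t0 al L : R) (sg : bool) (x : 'rV[R]_n).
Hypothesis L0 : 0 < L.
Hypothesis al1 : al < 1.
Local Notation root := (root_cell p t0 sg al x L).

Lemma measurable_root_cell : measurable (root : set (spacetime R n)).
Proof.
apply: measurable_spacetime; apply: measurableX.
  exact: measurable_half_open_cube.
exact: measurable_slab.
Qed.

Let al_lt : al * L `^ p < L `^ p.
Proof. by rewrite -[ltRHS]mul1r ltr_pM2r// powR_gt0. Qed.

Lemma lebesgue_root_cell :
  lebesgue_spacetime root = ((2 * L) ^+ n * ((1 - al) * L `^ p))%:E.
Proof.
rewrite lebesgue_spacetime_prod; last first.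
- exact: measurable_slab.
- exact: measurable_half_open_cube.
by rewrite lebesgue_half_open_cube// lebesgue_slab// -EFinM mulrBl mul1r.
Qed.

(** Both sets lie in the closed cube times the half-open slab, which has the same measure as the
    root cell. *)
Lemma near_root_cell_null :
  lebesgue_spacetime (near_part p sg al x t0 L `\` root) = 0%E.
Proof.
pose mu : {measure set (spacetime R n) -> \bar R} := @lebesgue_spacetime R n.
pose W : set (spacetime R n) := cube x L `*` slab t0 sg (al * L `^ p) (L `^ p).
have mW : measurable W.
  apply: measurable_spacetime; apply: measurableX.
    exact: measurable_cube.
  exact: measurable_slab.
have mR := measurable_root_cell.
have muW : mu W = mu root.
  rewrite /mu /= lebesgue_root_cell lebesgue_spacetime_prod; last first.
  - exact: measurable_slab.
  - exact: measurable_cube.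
  by rewrite lebesgue_cube// lebesgue_slab// -EFinM mulrBl mul1r.
have rW : root `<=` W by move=> z [/sub_half_open_cube].
have W0 : mu (W `\` root) = 0%E.
  have -> : mu (W `\` root) = (mu W - mu (W `&` root))%E.
    have Wfin : (mu W < +oo)%E by rewrite muW /mu /= lebesgue_root_cell ltry.
    by apply: measureD => //; exact: Wfin.
  by rewrite (setIidr rW) muW /mu /= lebesgue_root_cell subee.
apply/eqP; rewrite eq_le (measure_ge0 mu) andbT -W0; apply: (le_measure mu); rewrite ?inE.
- by apply: measurableD => //; exact: measurable_near_part.
- exact: measurableD.
- move=> z []; have := near_partE p t0 sg al x (L `^ p) L; rewrite of_stime0 => ->.
  move=> [hu hk] nz; split => //; split => //.
  by move: hk; rewrite /oslab /slab /=; lra.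
Qed.

End root_cell.

Lemma geometric_small (R : realType) (B x e : R) : 2 <= B -> 0 < e ->
  exists k, x / B ^+ k <= e.
Proof.
move=> B2 e0; exists (Num.trunc (x / e)).+1; set k := _.+1.
have Bk : 2 ^+ k <= B ^+ k by rewrite lerXn2r ?nnegrE//; exact: le_trans B2.
have B0 : 0 < B ^+ k by apply: lt_le_trans Bk; rewrite exprn_gt0.
rewrite ler_pdivrMr// mulrC -ler_pdivrMr//; apply: le_trans Bk.
have [x0e|x0e] := leP 0 (x / e); last by rewrite (le_trans (ltW x0e))// exprn_ge0.
have /andP[_ /ltW h] := truncn_itv x0e; apply: le_trans h _.
by rewrite -natrX ler_nat ltnW// ltn_expl.
Qed.

(** * Grid cells, their rectangles, shifts and dilates *)

Section grid.
Context (R : realType) (n : nat) (p ga al L t0 : R) (x0 : 'rV[R]_n).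
Context (sg : bool) (m : nat).
Hypothesis hp : 1 < p.
Hypothesis L0 : 0 < L.
Hypothesis ga0 : 0 <= ga.
Hypothesis gaal : ga < al.
Hypothesis al1 : al < 1.
Hypothesis hm : 2 <= (al - ga) * time_ratio p m.
Hypothesis m0 : (0 < m)%N.

Local Notation side := (side L m).
Local Notation height := (height p L m).
Local Notation tick := (tick p al L m).
Local Notation stime := (stime t0 sg).
Local Notation point := ('rV[R]_n * measurableTypeR R)%type.
Implicit Types (z w : point) (i j : nat).

(** The root cell is rescaled to the unit cube. Labels are defined on all of spacetime, since
    shifted cells may leave the root cell. *)
Definition grid_label i z : 'rV[int]_n * int :=
  (\row_a Num.floor ((space_scale m i)%:R * ((z.1 ord0 a - x0 ord0 a + L) / (2 * L))),
   Num.floor ((time_scale p m i)%:R * ((stime z.2 / L `^ p - al) / (1 - al)))).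

Definition center i (u : 'rV[int]_n) : 'rV[R]_n :=
  \row_a (x0 ord0 a - L + side i * (2 * (u ord0 a)%:~R + 1)).
Definition bottom i (k : int) : R := al * L `^ p + k%:~R * tick i.

Let LP : 0 < L `^ p. Proof. exact: powR_gt0. Qed.
Let side_pos i : 0 < side i. Proof. exact: side_gt0. Qed.
Let height_pos i : 0 < height i. Proof. exact: height_gt0. Qed.
Let tick_pos i : 0 < tick i. Proof. exact: tick_gt0. Qed.
Let tick_le2 i : 2 * tick i <= (1 - al) * height i. Proof. exact: tick_le. Qed.
Let space_scale_pos i : 0 < (space_scale m i)%:R :> R.
Proof. by rewrite ltr0n space_scale_gt0. Qed.
Let time_scale_pos i : 0 < (time_scale p m i)%:R :> R.
Proof. by rewrite ltr0n time_scale_gt0. Qed.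

Lemma grid_labelP i z u k : grid_label i z = (u, k) <->
  half_open_cube (center i u) (side i) z.1 /\
  bottom i k <= stime z.2 < bottom i k + tick i.
Proof.
pose y a := (space_scale m i)%:R * ((z.1 ord0 a - x0 ord0 a + L) / (2 * L)).
have spaceP a (v : int) : (Num.floor (y a) == v) =
    (x0 ord0 a - L + 2 * side i * v%:~R <= z.1 ord0 a
       < x0 ord0 a - L + 2 * side i * v%:~R + 2 * side i).
  have s2 : 0 < 2 * side i by rewrite mulr_gt0.
  rewrite floor_eq intrD -(ler_pM2l s2) -(ltr_pM2l s2).
  have -> : 2 * side i * y a = z.1 ord0 a - x0 ord0 a + L.
    by rewrite /y /side; field; rewrite !gt_eqF.
  by rewrite mulrDr mulr1; apply/idP/idP; lra.
pose w := (time_scale p m i)%:R * ((stime z.2 / L `^ p - al) / (1 - al)).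
have timeP (v : int) : (Num.floor w == v) =
    (bottom i v <= stime z.2 < bottom i v + tick i).
  rewrite floor_eq intrD -(ler_pM2l (tick_pos i)) -(ltr_pM2l (tick_pos i)).
  have -> : tick i * ((time_scale p m i)%:R * ((stime z.2 / L `^ p - al) / (1 - al))) =
      stime z.2 - al * L `^ p.
    by rewrite /tick; field; rewrite !gt_eqF// subr_gt0.
  by rewrite mulrDr mulr1 /bottom (mulrC (tick i)); apply/idP/idP; lra.
split=> [[<- <-]|[hu hk]].
  split => [a|]; last by rewrite -timeP.
  have /idP := eqxx (Num.floor (y a)).
  by rewrite spaceP !mxE; lra.
congr (_, _); last by apply/eqP; rewrite timeP.
apply/rowP => a; rewrite mxE; apply/eqP; rewrite spaceP.
by have := hu a; rewrite mxE; lra.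
Qed.

Lemma grid_label_refine i z z' : grid_label i.+1 z = grid_label i.+1 z' ->
  grid_label i z = grid_label i z'.
Proof.
move=> [/rowP hu hk]; congr (_, _); last first.
  have [N N0 KE] := time_scaleS m hp i.
  by move: hk; rewrite KE natrM -!mulrA; exact: floor_mul_nat.
apply/rowP => a; have := hu a; rewrite !mxE space_scaleS natrM -!mulrA.
by apply: floor_mul_nat; rewrite expn_gt0.
Qed.

Lemma grid_label_space_le i j z z' : (i <= j)%N ->
  (grid_label j z).1 = (grid_label j z').1 -> (grid_label i z).1 = (grid_label i z').1.
Proof.
elim: j => [|j IH]; first by rewrite leqn0 => /eqP->.
rewrite leq_eqVlt => /orP[/eqP->//|]; rewrite ltnS => /IH h h'; apply: h.
move: h'; rewrite /grid_label /= => /rowP hu; apply/rowP => a; have := hu a.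
rewrite !mxE space_scaleS natrM -!mulrA.
by apply: floor_mul_nat; rewrite expn_gt0.
Qed.

Lemma grid_cellE i u k : [set z | grid_label i z = (u, k)] =
  half_open_cube (center i u) (side i) `*`
    slab t0 sg (bottom i k) (bottom i k + tick i).
Proof.
by apply/seteqP; split => [z /grid_labelP[]|z [hu hk]] //; exact/grid_labelP.
Qed.

Lemma measurable_grid_cell i (u : 'rV[int]_n * int) :
  measurable ([set z | grid_label i z = u] : set (spacetime R n)).
Proof.
case: u => u k; rewrite grid_cellE; apply: measurable_spacetime.
by apply: measurableX; [exact: measurable_half_open_cube|exact: measurable_slab].
Qed.

Definition cell_measure i : R := (2 * side i) ^+ n * tick i.

Lemma cell_measure_gt0 i : 0 < cell_measure i.
Proof. by rewrite mulr_gt0// exprn_gt0// mulr_gt0. Qed.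

Lemma lebesgue_grid_cell i u :
  lebesgue_spacetime [set z | grid_label i z = u] = (cell_measure i)%:E.
Proof.
case: u => u k; rewrite grid_cellE lebesgue_spacetime_prod; last first.
- exact: measurable_slab.
- exact: measurable_half_open_cube.
rewrite lebesgue_half_open_cube// lebesgue_slab; last by rewrite ltrDl.
by rewrite -EFinM; congr (_ * _)%:E; lra.
Qed.

Local Notation root_cell := (root_cell p t0 sg al x0 L).

(** The least number of whole ticks that add up to [(1 + ga) * height i]; whole, so that the shift
    carries cells onto cells. *)
Definition shift_count i : int := Num.ceil ((1 + ga) * height i / tick i).

Definition shift i z : point :=
  (z.1, of_stime t0 sg (stime z.2 - (shift_count i)%:~R * tick i)).

Lemma shift_count_bound i : (1 + ga) * height i <= (shift_count i)%:~R * tick i /\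
  (shift_count i)%:~R * tick i < (1 + ga) * height i + tick i.
Proof.
have /andP[h1 h2] := ceil_itv ((1 + ga) * height i / tick i); split.
  by rewrite -ler_pdivrMr.
by move: h1; rewrite intrD -/(shift_count i) ltr_pdivlMr// mulrDl mulN1r ltrBlDr.
Qed.

Lemma grid_label_shift i z : grid_label i (shift i z) =
  ((grid_label i z).1, (grid_label i z).2 - shift_count i).
Proof.
have /grid_labelP[hu hk] : grid_label i z = ((grid_label i z).1, (grid_label i z).2).
  by case: grid_label.
apply/grid_labelP; split => //.
rewrite /shift of_stimeK /bottom intrB mulrBl.
by move: hk; rewrite /bottom; lra.
Qed.

Lemma grid_label_shift_time i z w : grid_label i w = grid_label i (shift i z) ->
  stime z.2 - 2 * height i < stime w.2 < stime z.2.
Proof.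
rewrite grid_label_shift => /grid_labelP[_ hw].
have /grid_labelP[_ hz] : grid_label i z = ((grid_label i z).1, (grid_label i z).2).
  by case: grid_label.
have [h1 h2] := shift_count_bound i.
have := tick_le2 i; have := tick_pos i; have := height_pos i.
move: hw; rewrite /bottom intrB mulrBl; move: hz; rewrite /bottom.
have : ga * height i <= al * height i by rewrite ler_wpM2r// ltW.
move: h1 h2; rewrite !mulrDl !mul1r.
have : 0 <= ga * height i by rewrite mulr_ge0// ltW.
lra.
Qed.

Lemma grid_label_shift_space i j z w : (i <= j)%N ->
  grid_label j w = grid_label j (shift j z) -> (grid_label i w).1 = (grid_label i z).1.
Proof.
move=> ij h; apply: (grid_label_space_le ij); by rewrite h grid_label_shift.
Qed.

Lemma root_cellP i z : root_cell z <->
  (forall a, 0 <= (grid_label i z).1 ord0 a < (space_scale m i)%:Z) /\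
  0 <= (grid_label i z).2 < (time_scale p m i)%:Z.
Proof.
have e1 a : 0 <= (grid_label i z).1 ord0 a < (space_scale m i)%:Z =
    (x0 ord0 a - L <= z.1 ord0 a < x0 ord0 a + L).
  rewrite /grid_label mxE floor_ge0 ltNge floor_ge_int -pmulrn -ltNge.
  rewrite pmulr_rge0// -[X in _ && (_ < X)]mulr1 ltr_pM2l//.
  by rewrite ler_pdivlMr ?mulr_gt0// ltr_pdivrMr ?mulr_gt0//; apply/idP/idP; lra.
have e2 : 0 <= (grid_label i z).2 < (time_scale p m i)%:Z =
    (al * L `^ p <= stime z.2 < L `^ p).
  rewrite /grid_label /= floor_ge0 ltNge floor_ge_int -pmulrn -ltNge.
  rewrite pmulr_rge0// -[X in _ && (_ < X)]mulr1 ltr_pM2l//.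
  rewrite ler_pdivlMr ?subr_gt0// ltr_pdivrMr ?subr_gt0// mul0r mul1r.
  by rewrite subr_ge0 ltrBlDr subrK ler_pdivlMr// ltr_pdivrMr// mul1r.
by rewrite e2; split=> -[h ?]; split => // a; have := h a; rewrite e1.
Qed.

Lemma saturated_root_cell i : saturated grid_label i root_cell.
Proof. by move=> z z' zz' /(root_cellP i); rewrite zz' => h; apply/(root_cellP i). Qed.

Lemma root_cell_bounds i z u k : root_cell z -> grid_label i z = (u, k) ->
  (forall a, x0 ord0 a - L <= center i u ord0 a - side i /\
             center i u ord0 a + side i <= x0 ord0 a + L) /\
  al * L `^ p <= bottom i k /\ bottom i k + tick i <= L `^ p.
Proof.
move=> /(root_cellP i) Sz zuk; move: Sz; rewrite zuk /= => -[hu /andP[k0 kK]].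
have lez (v : int) (N : nat) : v < N%:Z -> v%:~R + 1 <= N%:R :> R.
  by rewrite -lezD1 -(ler_int R) intrD.
split=> [a|].
  have /andP[u0 ub] := hu a; rewrite mxE.
  have u0' : 0 <= (u ord0 a)%:~R :> R by rewrite ler0z.
  have : side i * ((u ord0 a)%:~R + 1) <= L.
    rewrite -[leRHS](divfK (_ : (space_scale m i)%:R != 0 :> R)) ?gt_eqF//.
    by rewrite ler_pM2l//; exact: lez.
  have : 0 <= side i * (u ord0 a)%:~R by rewrite mulr_ge0// ltW.
  lra.
have k0' : 0 <= k%:~R :> R by rewrite ler0z.
have : tick i * (k%:~R + 1) <= (1 - al) * L `^ p.
  rewrite -[leRHS](divfK (_ : (time_scale p m i)%:R != 0 :> R)) ?gt_eqF//.
  by rewrite ler_pM2l//; exact: lez.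
have : 0 <= k%:~R * tick i by rewrite mulr_ge0// ltW.
rewrite /bottom; lra.
Qed.

(** Chosen so that the rectangle ends at the top of the cell. *)
Definition center_time i k : R := of_stime t0 sg (bottom i k + tick i - height i).

Definition near_rect i (v : 'rV[int]_n * int) : set point :=
  near_part p sg ga (center i v.1) (center_time i v.2) (side i).
Definition far_rect i (v : 'rV[int]_n * int) : set point :=
  far_part p sg ga (center i v.1) (center_time i v.2) (side i).

Lemma grid_prectE i v : prect p (center i v.1) (center_time i v.2) (side i) =
  cube (center i v.1) (side i) `*`
    oslab t0 sg (bottom i v.2 + tick i - 2 * height i) (bottom i v.2 + tick i).
Proof. by rewrite /center_time /height prectE. Qed.

Lemma near_rectE i v : near_rect i v = cube (center i v.1) (side i) `*`
  oslab t0 sg (bottom i v.2 + tick i - (1 - ga) * height i) (bottom i v.2 + tick i).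
Proof. by rewrite /near_rect /center_time /height near_partE. Qed.

Lemma far_rectE i v : far_rect i v = cube (center i v.1) (side i) `*`
  oslab t0 sg (bottom i v.2 + tick i - 2 * height i)
              (bottom i v.2 + tick i - (1 + ga) * height i).
Proof. by rewrite /far_rect /center_time /height far_partE. Qed.

Lemma measurable_near_rect i v : measurable (near_rect i v : set (spacetime R n)).
Proof. exact: measurable_near_part. Qed.

Lemma measurable_far_rect i v : measurable (far_rect i v : set (spacetime R n)).
Proof. exact: measurable_far_part. Qed.

Lemma cube_center i w u k : grid_label i w = (u, k) -> cube (center i u) (side i) w.1.
Proof. by move=> /grid_labelP[/sub_half_open_cube]. Qed.

(** The root cell starts at signed time [al * L ^ p] and the rectangle reaches back less than
    [(al - ga) * L ^ p] from there, so it remains at positive signed times. *)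
Lemma prect_grid_sub i z v : (0 < i)%N -> root_cell z -> grid_label i z = v ->
  prect p (center i v.1) (center_time i v.2) (side i) `<=` prect p x0 t0 L.
Proof.
case: v => u k i0 Sz zuk; have [hu [h1 h2]] := root_cell_bounds Sz zuk.
have := prectE p t0 sg x0 (L `^ p) L; rewrite of_stime0 => ->.
rewrite grid_prectE => -[y s] [hy hs]; split.
  move=> a; have := hy a; have [] := hu a; rewrite !ler_distl /=; lra.
have : 2 * height i <= (al - ga) * height 0 by apply: height_succ.
rewrite height0// => hi; move: hs hi; rewrite /oslab /=.
have : 0 <= ga * L `^ p by rewrite mulr_ge0// ltW.
have := LP; have := tick_pos i; lra.
Qed.

Lemma grid_cell_near i v : [set z | grid_label i z = v] `<=` near_rect i v.
Proof.
case: v => u k w /= wuk; rewrite near_rectE; split; first exact: cube_center wuk.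
have /grid_labelP[_] := wuk; rewrite /oslab /=.
have := tick_le2 i; have := tick_pos i; have := height_pos i.
have : (1 - al) * height i <= (1 - ga) * height i by rewrite ler_wpM2r ?lerB// ltW.
lra.
Qed.

(** The shift goes back at most [(al - ga) * height i] from a point within one tick, hence within
    [(1 - al) * height i], of the top; together this is the depth [(1 - ga) * height i] of the near
    part. *)
Lemma shift_cell_near i j z v : (i < j)%N -> grid_label i z = v ->
  cell grid_label j (shift j z) `<=` near_rect i v.
Proof.
case: v => u k ij zuk w wz; rewrite near_rectE; split.
  have := grid_label_shift_space (ltnW ij) wz; rewrite zuk.
  by case wuk : (grid_label i w) => [u' k'] /= <-; exact: cube_center wuk.
have /grid_labelP[_] := zuk; rewrite /oslab /=.
have := grid_label_shift_time wz.
have : 2 * height j <= (al - ga) * height i by apply: height_succ.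
have := tick_le2 i; have := tick_pos i; have := height_pos i.
lra.
Qed.

Lemma shift_cell_root j z : (0 < j)%N -> root_cell z ->
  cell grid_label j (shift j z) `<=` near_part p sg ga x0 t0 L.
Proof.
move=> j0 Sz w wz.
have := near_partE p t0 sg ga x0 (L `^ p) L; rewrite of_stime0 => ->; split.
  case zuk : (grid_label 0 z) => [u k].
  have := grid_label_shift_space (ltnW j0) wz; rewrite zuk.
  case wuk : (grid_label 0 w) => [u' k'] /= uu'; rewrite uu' in wuk.
  have [hu _] := root_cell_bounds Sz zuk.
  have /grid_labelP[hw _] := wuk.
  by move=> a; have := hw a; have [] := hu a; rewrite ler_distl; lra.
have := grid_label_shift_time wz; rewrite /oslab /=.
have : 2 * height j <= (al - ga) * height 0 by apply: height_succ.
by rewrite height0//; move: Sz => [_]; rewrite /slab /=; lra.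
Qed.

(** The shift clears [(1 + ga) * height i] and overshoots by less than a tick; with the cell's own
    tick this stays within [2 * height i], because two ticks are at most [(1 - al) * height i]. *)
Lemma shift_cell_far i z v : grid_label i z = v ->
  cell grid_label i (shift i z) `<=` far_rect i v.
Proof.
case: v => u k zuk w; rewrite /cell /= grid_label_shift zuk => wuk.
rewrite far_rectE; split; first exact: cube_center wuk.
move: wuk => /grid_labelP[_].
have [h1 h2] := shift_count_bound i.
have : (1 - al) * height i <= (1 - ga) * height i by rewrite ler_wpM2r ?lerB// ltW.
have := tick_le2 i; have := tick_pos i; have := height_pos i.
rewrite /oslab /= /bottom intrB mulrBl; move: h1 h2.
lra.
Qed.

(** A cell extended forward by [2 * height i], which exceeds the shift of every generation from [i]
    on, so that it recovers the unshifted points. *)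
Definition dilate i (u : 'rV[int]_n * int) : set point :=
  half_open_cube (center i u.1) (side i) `*`
    slab t0 sg (bottom i u.2) (bottom i u.2 + tick i + 2 * height i).

Lemma measurable_dilate i u : measurable (dilate i u : set (spacetime R n)).
Proof.
apply: measurable_spacetime.
by apply: measurableX; [exact: measurable_half_open_cube|exact: measurable_slab].
Qed.

Lemma lebesgue_dilate i u : (lebesgue_spacetime (dilate i u) <=
  ((1 + 8 / (1 - al)) * cell_measure i)%:E)%E.
Proof.
rewrite lebesgue_spacetime_prod; last first.
- exact: measurable_slab.
- exact: measurable_half_open_cube.
have := tick_pos i; have := height_pos i => hi ti.
rewrite lebesgue_half_open_cube// lebesgue_slab; last by lra.
rewrite -EFinM lee_fin /cell_measure [leRHS]mulrCA ler_pM2l; last first.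
  by rewrite exprn_gt0// mulr_gt0.
have : height i <= 4 * tick i / (1 - al).
  by rewrite ler_pdivlMr ?subr_gt0// mulrC; apply: tick_ge.
rewrite mulrAC; lra.
Qed.

Lemma dilate_cover i j z z' : (i <= j)%N ->
  grid_label i (shift j z) = grid_label i (shift i z') ->
  dilate i (grid_label i (shift i z')) z.
Proof.
move=> ij <-; case zuk : (grid_label i (shift j z)) => [u k].
have /grid_labelP[hu hk] := zuk; split => //.
have := @grid_label_shift_time j z (shift j z) erefl.
have := height_le m hp L0 ij; move: hk; rewrite /slab /=; lra.
Qed.

(** Space contributes exactly [2^(m n)]; time contributes at most [2 * time_ratio], the factor 2
    coming from the rounding of [time_scale] to powers of two. *)
Lemma cell_measure_doubling i :
  cell_measure i <= 2 ^+ (m * n).+1 * time_ratio p m * cell_measure i.+1.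
Proof.
have r0 : 0 < time_ratio p m by exact: time_ratio_gt0.
have -> : cell_measure i.+1 =
    (2 ^+ (m * n))^-1 * (2 * side i) ^+ n *
    (tick i * (time_scale p m i)%:R / (time_scale p m i.+1)%:R).
  rewrite /cell_measure; congr (_ * _).
    rewrite /side space_scaleS natrM natrX exprM -exprVn -exprMn; congr (_ ^+ _).
    by field; rewrite !gt_eqF// exprn_gt0.
  by rewrite /tick divfK// gt_eqF.
rewrite /cell_measure exprS.
have e0 : 0 < 2 ^+ (m * n) :> R by rewrite exprn_gt0.
set A := (2 * side i) ^+ n; set E := 2 ^+ (m * n) in e0 *.
have A0 : 0 < A by rewrite exprn_gt0// mulr_gt0.
rewrite (_ : _ * _ * _ = A * tick i *
    (2 * time_ratio p m * (time_scale p m i)%:R / (time_scale p m i.+1)%:R)); last first.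
  by field; rewrite !gt_eqF.
apply: ler_peMr; first by rewrite ltW// mulr_gt0.
rewrite ler_pdivlMr// mul1r.
have := time_scale_le m hp i.+1; have := time_scale_ge m hp i; rewrite exprS => h1 h2.
apply: le_trans h2 _.
rewrite (_ : 4 * _ = 2 * time_ratio p m * (2 * time_ratio p m ^+ i)); last by ring.
by rewrite ler_pM2l ?mulr_gt0.
Qed.

Let ratio2 : 2 <= time_ratio p m.
Proof.
apply: le_trans (time_ratio_ge m hp); rewrite -[leLHS]expr1.
by rewrite ler_weXn2l// ler1n.
Qed.

Lemma grid_fine_space (a : 'I_n) (r : R) z : z.1 ord0 a < r ->
  exists k, forall w, grid_label k w = grid_label k z -> w.1 ord0 a < r.
Proof.
move=> zr; have e0 : 0 < (r - z.1 ord0 a) / 2 by rewrite divr_gt0// subr_gt0.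
have [|k hk] := @geometric_small R (2 ^+ m) L _ _ e0.
  by rewrite -[leLHS]expr1 ler_weXn2l// ler1n.
exists k => w; case zuk : (grid_label k z) => [u v] wuk.
have /grid_labelP[/(_ a) + _] := zuk; have /grid_labelP[/(_ a) + _] := wuk.
have : side k <= (r - z.1 ord0 a) / 2 by rewrite /side /space_scale natrX exprM.
lra.
Qed.

Lemma grid_fine_time (r : R) z : z.2 < r ->
  exists k, forall w, grid_label k w = grid_label k z -> w.2 < r.
Proof.
move=> zr; have e0 : 0 < r - z.2 by rewrite subr_gt0.
have [k hk] := @geometric_small R _ (L `^ p) _ ratio2 e0.
exists k => w; case zuk : (grid_label k z) => [u v] wuk.
have /grid_labelP[_ hz] := zuk; have /grid_labelP[_ hw] := wuk.
have : tick k < r - z.2.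
  apply: lt_le_trans hk; rewrite -heightE//.
  have := tick_le2 k; have := height_pos k.
  have : (1 - al) * height k <= height k.
    by apply: ler_piMl; [exact: ltW|have := ga0; have := gaal; lra].
  lra.
by move: hz hw; rewrite /stime; case: (sg); lra.
Qed.

(** The dilation constant plus the doubling constant, so that one number serves as both. *)
Definition dil_const : R := 1 + 8 / (1 - al) + 2 ^+ (m * n).+1 * time_ratio p m.

Lemma dil_const_ge1 : 1 <= dil_const.
Proof.
rewrite /dil_const -addrA lerDl addr_ge0// ltW//.
  by rewrite divr_gt0 ?subr_gt0.
by rewrite mulr_gt0 ?exprn_gt0// time_ratio_gt0.
Qed.

Let mu : {measure set (spacetime R n) -> \bar R} := @lebesgue_spacetime R n.

Lemma lebesgue_near_le i v : (mu (near_rect i v) <=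
  (4 * (1 - ga) / (1 - al) * cell_measure i)%:E)%E.
Proof.
have -> : mu (near_rect i v) = ((2 * side i) ^+ n * ((1 - ga) * height i))%:E.
  by apply: lebesgue_near_part => //; exact: lt_trans al1.
rewrite lee_fin /cell_measure -/(height i) [leRHS]mulrCA ler_pM2l; last first.
  by rewrite exprn_gt0// mulr_gt0.
rewrite (mulrC 4) -!mulrA ler_pM2l; last by rewrite subr_gt0 (lt_trans gaal).
rewrite mulrCA ler_pdivlMl ?subr_gt0//; exact: tick_ge.
Qed.

Lemma lebesgue_far_le i v : (mu (far_rect i v) <=
  (4 * (1 - ga) / (1 - al) * cell_measure i)%:E)%E.
Proof.
have -> : mu (far_rect i v) = mu (near_rect i v); last exact: lebesgue_near_le.
have g1 := lt_trans gaal al1.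
exact: etrans (lebesgue_far_part _ _ _ _ g1 _) (esym (lebesgue_near_part _ _ _ _ g1 _)).
Qed.

(** Either part of a rectangle measures at most [4 (1 - ga) / (1 - al)] times its cell, so a
    proportion [eta] of the part becomes the proportion [1/(4C)] of the cell required by the
    stopping argument, with [C = dil_const]. *)
Lemma grid_decay (F : spacetime R n -> R) (s0 eta c0 : R) (k : nat) :
  measurable_fun setT F -> 0 <= s0 -> 0 <= eta ->
  4 * (1 - ga) / (1 - al) * eta <= (4 * dil_const)^-1 ->
  (forall x t l, 0 < l -> prect p x t l `<=` prect p x0 t0 L -> exists c,
    (mu (near_part p sg ga x t l `&` [set w | (c + s0 < F w)%R]) <=
       eta%:E * mu (near_part p sg ga x t l))%E /\
    (mu (far_part p sg ga x t l `&` [set w | (F w < c - s0)%R]) <=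
       eta%:E * mu (far_part p sg ga x t l))%E) ->
  (mu (near_part p sg ga x0 t0 L `&` [set w | (c0 + s0 < F w)%R]) <=
     eta%:E * mu (near_part p sg ga x0 t0 L))%E ->
  (mu (root_cell `&` [set w | (c0 + (s0 + k.+1%:R * (4 * s0)) < F w)%R]) <=
    (2^-1 ^+ k * (2 * dil_const))%:E *
      mu (near_part p sg ga x0 t0 L `&` [set w | (c0 + s0 < F w)%R]))%E.
Proof.
move=> mF s00 eta0 heta hF hroot.
pose good i v c :=
  (mu (near_rect i v `&` [set w | (c + s0 < F w)%R]) <= eta%:E * mu (near_rect i v))%E /\
  (mu (far_rect i v `&` [set w | (F w < c - s0)%R]) <= eta%:E * mu (far_rect i v))%E.
(* Chosen from the label rather than the point, so that it is constant on cells. The default 0 is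
   taken only at labels without a good constant, which do not occur in the root cell at positive
   generations. *)
pose cstar i v := xget 0 [set c | good i v c].
have cstarP i z : (0 < i)%N -> root_cell z ->
    good i (grid_label i z) (cstar i (grid_label i z)).
  move=> i0 Sz; have := prect_grid_sub i0 Sz erefl.
  move=> /(hF _ _ _ (side_pos i))[c hc].
  by have := @xgetPex _ 0 [set c | good i (grid_label i z) c]; apply; exists c.
have D1 := dil_const_ge1.
have eta_small (x : R) i : 0 < x -> x <= 4 * dil_const ->
    4 * (1 - ga) / (1 - al) * cell_measure i * eta <= x^-1 * cell_measure i.
  move=> xp xD; rewrite mulrAC ler_pM2r ?cell_measure_gt0//.
  by apply: le_trans heta _; rewrite lef_pV2 ?posrE ?mulr_gt0// (lt_le_trans _ D1).
have D0 : 0 < dil_const by exact: lt_le_trans D1.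
have D4 : 4 <= 4 * dil_const by rewrite ler_peMr.
have near_small (E : set (spacetime R n)) (x : R) i (A : set (spacetime R n)) :
    (mu E <= eta%:E * mu A)%E ->
    (mu A <= (4 * (1 - ga) / (1 - al) * cell_measure i)%:E)%E ->
    0 < x -> x <= 4 * dil_const -> (mu E <= (x^-1 * cell_measure i)%:E)%E.
  move=> h1 h2 x0' x4; apply: le_trans h1 _.
  apply: (@le_trans _ _ (eta%:E * (4 * (1 - ga) / (1 - al) * cell_measure i)%:E)%E).
    by apply: lee_wpmul2l; rewrite ?lee_fin.
  by rewrite -EFinM lee_fin mulrC eta_small.
apply: (@root_decay _ _ _ mu _ grid_label measurable_grid_cell grid_label_refine
  _ cell_measure dil_const s0 root_cell shift dilate
  (fun i z => near_rect i (grid_label i z))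
  (fun i z => cstar i (grid_label i z)) F) => //.
- move=> X G e mX mG Xoo e0.
  exact: (spacetime_approximable measurable_grid_cell grid_label_refine
    grid_fine_space grid_fine_time mX mG Xoo e0).
- exact: cell_measure_gt0.
- by move=> i z; exact: lebesgue_grid_cell.
- move=> i; apply: le_trans (cell_measure_doubling i) _.
  rewrite ler_pM2r ?cell_measure_gt0// /dil_const lerDr addr_ge0//.
  by rewrite divr_ge0// subr_ge0 ltW.
- by rewrite /mu /= lebesgue_root_cell// ltry.
- exact: saturated_root_cell.
- by move=> i z z' ->.
- by move=> i z; exact: measurable_near_rect.
- exact: measurable_dilate.
- move=> i u; apply: le_trans (lebesgue_dilate i u) _; rewrite lee_fin.
  rewrite ler_pM2r ?cell_measure_gt0// /dil_const lerDl mulr_ge0// ?exprn_ge0//.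
  exact/ltW/time_ratio_gt0.
- by move=> i j z z' /andP[_ ij] _ _; exact: dilate_cover.
- by move=> i z _ _; exact: grid_cell_near.
- by move=> i j z z' /andP[_ ij] _ zz'; apply: shift_cell_near.
- move=> i z i0 Sz; have [h _] := cstarP i z i0 Sz.
  by apply: near_small h (lebesgue_near_le i _) _ _ => //; rewrite mulr_gt0.
- move=> i z i0 Sz; have [_ h] := cstarP i z i0 Sz.
  have mc : measurable (cell grid_label i (shift i z) : set (spacetime R n)).
    exact: measurable_grid_cell.
  have ml : measurable
      ([set w | F w < cstar i (grid_label i z) - s0] : set (spacetime R n)).
    exact: measurable_lt_level.
  apply: (@le_trans _ _ (mu (far_rect i (grid_label i z) `&`
      [set w | F w < cstar i (grid_label i z) - s0]%R))).
    apply: le_measure; rewrite ?inE; [exact: measurableI| |].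
      by apply: measurableI => //; exact: measurable_far_rect.
    by move=> w [/(shift_cell_far erefl)].
  exact: near_small h (lebesgue_far_le i _) _ _.
- exact: measurable_near_part.
- exact: shift_cell_root.
(* The near part of the whole rectangle is compared with a cell of generation 0; doubling then
   passes to generation 1. *)
- have h0 := near_small _ (4 * dil_const) 0%N _ hroot.
  apply: le_trans (h0 _ _ _) _ => //.
  + have -> : mu (near_part p sg ga x0 t0 L) =
        ((2 * L) ^+ n * ((1 - ga) * L `^ p))%:E.
      by apply: lebesgue_near_part => //; exact: lt_trans al1.
    rewrite lee_fin /cell_measure {1}/side /space_scale muln0 expn0 divr1.
    rewrite -(height0 m hp L0) [leRHS]mulrCA ler_pM2l; last first.
      by rewrite exprn_gt0// mulr_gt0.
    rewrite (mulrC 4) -!mulrA ler_pM2l; last by rewrite subr_gt0 (lt_trans gaal).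
    by rewrite mulrCA ler_pdivlMl ?subr_gt0//; exact: tick_ge.
  + by rewrite mulr_gt0.
  + rewrite lee_fin invfM -mulrA ler_pM2l ?invr_gt0// ler_pdivrMl//.
    apply: le_trans (cell_measure_doubling 0) _.
    rewrite ler_pM2r ?cell_measure_gt0// /dil_const lerDr addr_ge0//.
    by rewrite divr_ge0// subr_ge0 ltW.
Qed.

End grid.

(** * From mean oscillation to superlevel sets *)

Lemma measurable_pos_powR d (T : measurableType d) (R : realType) (E : set T)
    (h : T -> R) (c q : R) : measurable_fun setT h ->
  measurable_fun E (EFin \o (fun z => (Num.max (h z - c) 0) `^ q)).
Proof.
move=> mh; apply: measurable_funTS; apply/measurable_EFinP.
apply: (measurableT_comp (measurable_realfun.measurable_powR q)).
by apply: measurable_maxr => //; exact: measurable_funB.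
Qed.

Lemma powR_chebyshev d (T : measurableType d) (R : realType)
    (mu : {measure set T -> \bar R}) (E : set T) (h : T -> R) (c q s : R) :
  measurable E -> measurable_fun setT h -> 0 < q -> 0 < s ->
  (mu (E `&` [set z | (c + s < h z)%R]) <=
   (s `^ q)^-1%:E * \int[mu]_(z in E) ((Num.max (h z - c) 0) `^ q)%:E)%E.
Proof.
move=> mE mh q0 s0; have sq : 0 < s `^ q by exact: powR_gt0.
have mA : measurable (E `&` [set z | (c + s < h z)%R]).
  by apply: measurableI => //; exact: measurable_level.
rewrite muleC -lee_pdivrMr ?invr_gt0// invrK muleC.
rewrite -integral_cst//.
apply: (@le_trans _ _ (\int[mu]_(z in E `&` [set z | (c + s < h z)%R])
    ((Num.max (h z - c) 0) `^ q)%:E)%E).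
  apply: ge0_le_integral => //.
  - by move=> z _; rewrite lee_fin ltW.
  - exact: measurable_pos_powR.
  - move=> z [_ /= hz]; rewrite lee_fin.
    apply: ge0_ler_powR; rewrite ?nnegrE ?le_max ?lexx ?orbT// ?(ltW s0) ?(ltW q0)//.
    by apply/orP; left; lra.
apply: ge0_subset_integral => //.
- exact: measurable_pos_powR.
- by move=> z _; rewrite lee_fin powR_ge0.
Qed.

Lemma average_le_of_poweR (R : realType) (a b : \bar R) (q M : R) :
  (0 <= a)%E -> (0 <= b)%E -> 0 < q -> 0 <= M -> ((a + b) `^ q^-1 <= M%:E)%E ->
  (a <= (M `^ q)%:E)%E /\ (b <= (M `^ q)%:E)%E.
Proof.
move=> a0 b0 q0 M0 h.
have hab : (a + b <= (M `^ q)%:E)%E.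
  rewrite -(poweRe1 (adde_ge0 a0 b0)) -(@mulVf _ q) ?gt_eqF// poweRrM -poweR_EFin.
  apply: gt0_ler_poweR; [exact: ltW| | |exact: h];
    by rewrite in_itv/= leey andbT ?poweR_ge0// lee_fin.
split; apply: le_trans hab; first by rewrite leeDl.
by rewrite leeDr.
Qed.

Lemma integral_le_of_average (R : realType) n (E : set (spacetime R n))
    (g : 'rV[R]_n * R -> R) (r M : R) : 0 < r -> lebesgue_spacetime E = r%:E ->
  (integral_average E g <= M%:E)%E ->
  (\int[lebesgue_spacetime]_(z in E) (g z)%:E <= M%:E * lebesgue_spacetime E)%E.
Proof.
move=> r0 Er; rewrite /integral_average Er inver gt_eqF// => h.
by move: h; rewrite lee_pdivrMl// muleC.
Qed.

(** As [N] is positive, the infimum over constants is strictly below [2 * N], so some constant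
    achieves that bound; each average is then at most the sum of the two. *)
Lemma PBMO_sub_rectangle (R : realType) n (p gamma q t L : R) (x : 'rV[R]_n)
    (f F : 'rV[R]_n * R -> R) (N : R) :
  0 <= gamma -> gamma < 1 -> 0 < q -> 0 < N ->
  PBMO_norm p gamma q x t L f = N%:E ->
  (forall z, prect p x t L z -> F z = f z) ->
  forall y s l, 0 < l -> prect p y s l `<=` prect p x t L -> exists c : R,
    (\int[lebesgue_spacetime]_(z in prect_upper p gamma y s l)
        ((Num.max (F z - c) 0) `^ q)%:E <=
      ((2 * N) `^ q)%:E * lebesgue_spacetime (prect_upper p gamma y s l))%E /\
    (\int[lebesgue_spacetime]_(z in prect_lower p gamma y s l)
        ((Num.max (c - F z) 0) `^ q)%:E <=
      ((2 * N) `^ q)%:E * lebesgue_spacetime (prect_lower p gamma y s l))%E.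
Proof.
move=> g0 g1 q0 N0 NE Ff y s l l0 sub.
have : (ereal_inf (range (PBMO_oscillation p gamma q f y s l)) < (2 * N)%:E)%E.
  apply: (@le_lt_trans _ _ N%:E); last by rewrite lte_fin; lra.
  by rewrite -NE; apply: ereal_sup_ubound; exists (y, s, l).
move=> /ereal_inf_lt[_ [c _ <-] /ltW hc]; exists c.
have gm1 : -1 < gamma by lra.
have muu := lebesgue_near_part p true y s g1 l0.
have mul := lebesgue_near_part p false y s g1 l0.
have r0 : 0 < (2 * l) ^+ n * ((1 - gamma) * l `^ p).
  by rewrite mulr_gt0 ?exprn_gt0 ?mulr_gt0 ?subr_gt0 ?powR_gt0.
have avg0 (E : set (spacetime R n)) (g : 'rV[R]_n * R -> R) r :
    0 < r -> lebesgue_spacetime E = r%:E -> (forall z, 0 <= g z) ->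
    (0 <= integral_average E g)%E.
  move=> rp Er g0'; rewrite /integral_average Er inver gt_eqF// mule_ge0//.
    by rewrite lee_fin invr_ge0 ltW.
  by apply: integral_ge0 => z _; rewrite lee_fin.
have N2 : 0 <= 2 * N by rewrite mulr_ge0// ltW.
have [h1 h2] := average_le_of_poweR
  (avg0 _ _ _ r0 muu (fun z => powR_ge0 _ _))
  (avg0 _ _ _ r0 mul (fun z => powR_ge0 _ _)) q0 N2 hc.
split.
- apply: le_trans (integral_le_of_average r0 muu h1).
  rewrite le_eqVlt; apply/orP; left; apply/eqP/eq_integral => z; rewrite inE => zE.
  rewrite /funrpos /= Ff//; apply: sub.
  exact: (near_part_sub (sg := true) gm1 l0).
- apply: le_trans (integral_le_of_average r0 mul h2).
  rewrite le_eqVlt; apply/orP; left; apply/eqP/eq_integral => z; rewrite inE => zE.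
  rewrite /funrneg /= opprB Ff//; apply: sub.
  exact: (near_part_sub (sg := false) gm1 l0).
Qed.

(** * The one-sided estimate in signed time *)

Section one_sided.
Context (R : realType) (n : nat) (p q ga al : R) (m : nat).
Hypothesis hp : 1 < p.
Hypothesis q0 : 0 < q.
Hypothesis q1 : q <= 1.
Hypothesis ga0 : 0 <= ga.
Hypothesis gaal : ga < al.
Hypothesis al1 : al < 1.
Hypothesis hm : 2 <= (al - ga) * time_ratio p m.
Hypothesis m0 : (0 < m)%N.

Let D := dil_const n p al m.
(** The value for which the smallness condition of [grid_decay] is an equality. *)
Let eta : R := (1 - al) / (16 * D * (1 - ga)).
(** Solves [(2 / level_unit)^q = eta]: at height [level_unit * N] above the constant, Chebyshev's
    inequality leaves exactly the proportion [eta]. *)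
Definition level_unit : R := 2 / (eta `^ q^-1).
Let kap := level_unit.

Let D_gt0 : 0 < D.
Proof. exact: lt_le_trans (dil_const_ge1 n m hp al1). Qed.

Let ga1 : ga < 1. Proof. exact: lt_trans al1. Qed.

Let eta_gt0 : 0 < eta.
Proof. by rewrite divr_gt0 ?mulr_gt0 ?subr_gt0. Qed.

Lemma level_unit_gt0 : 0 < level_unit.
Proof. by rewrite divr_gt0// powR_gt0. Qed.

Let mu : {measure set (spacetime R n) -> \bar R} := @lebesgue_spacetime R n.

Lemma one_sided_estimate (L t0 : R) (x0 : 'rV[R]_n) (sg : bool)
    (G : spacetime R n -> R) (N c0 lambda : R) :
  0 < L -> measurable_fun setT G -> 0 < N ->
  (forall x t l, 0 < l -> prect p x t l `<=` prect p x0 t0 L -> exists c : R,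
    (\int[mu]_(z in near_part p sg ga x t l) ((Num.max (G z - c) 0) `^ q)%:E <=
       ((2 * N) `^ q)%:E * mu (near_part p sg ga x t l))%E /\
    (\int[mu]_(z in far_part p sg ga x t l) ((Num.max (c - G z) 0) `^ q)%:E <=
       ((2 * N) `^ q)%:E * mu (far_part p sg ga x t l))%E) ->
  (\int[mu]_(z in near_part p sg ga x0 t0 L) ((Num.max (G z - c0) 0) `^ q)%:E <=
       ((2 * N) `^ q)%:E * mu (near_part p sg ga x0 t0 L))%E ->
  8 * level_unit * N <= lambda -> N <= lambda ->
  (mu (near_part p sg al x0 t0 L `&` [set z | (lambda < Num.max (G z - c0) 0)%R]) <=
    (expR (- (ln 2 / (4 * level_unit) * (lambda / N) `^ q)) *
      (16 * D / level_unit `^ q / N `^ q))%:E *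
    \int[mu]_(z in near_part p sg ga x0 t0 L) ((Num.max (G z - c0) 0) `^ q)%:E)%E.
Proof.
move=> L0 mG N0 hG hroot hlam Nlam.
have kap0 : 0 < kap by exact: level_unit_gt0.
set s0 := kap * N; have s00 : 0 < s0 by rewrite mulr_gt0.
have s0q : (s0 `^ q)^-1 * (2 * N) `^ q = eta.
  have -> : 2 * N = s0 * eta `^ q^-1.
    by rewrite /s0 /kap /level_unit; field; rewrite gt_eqF// powR_gt0.
  rewrite powRM ?ltW ?powR_gt0// -powRrM mulVf ?gt_eqF// powRr1 ?ltW//.
  by rewrite mulKf// gt_eqF// powR_gt0.
have cheb E (h : spacetime R n -> R) c : measurable E -> measurable_fun setT h ->
    (\int[mu]_(z in E) ((Num.max (h z - c) 0) `^ q)%:E <= ((2 * N) `^ q)%:E * mu E)%E ->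
    (mu (E `&` [set w | (c + s0 < h w)%R]) <= eta%:E * mu E)%E.
  move=> mE mh hE; apply: le_trans (powR_chebyshev mu c mE mh q0 s00) _.
  rewrite -s0q EFinM -muleA; apply: lee_wpmul2l => //.
  by rewrite lee_fin invr_ge0 powR_ge0.
have heta : 4 * (1 - ga) / (1 - al) * eta <= (4 * dil_const n p al m)^-1.
  rewrite /eta -/D le_eqVlt; apply/orP; left; apply/eqP; field.
  by rewrite !gt_eqF ?subr_gt0.
set Lam := 4 * s0; have Lam0 : 0 < Lam by rewrite mulr_gt0.
have y2 : 2 <= lambda / Lam.
  by rewrite ler_pdivlMr// (_ : 2 * Lam = 8 * kap * N)// /Lam /s0; ring.
have /andP[t1 t2] := truncn_itv (le_trans (ler0n _ 2) y2).
have t0' : (2 <= Num.trunc (lambda / Lam))%N.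
  by rewrite truncn_ge_nat// (le_trans _ y2).
(* Of the [k + 2] whole steps [Lam] below [lambda], one absorbs the offset [s0] and one is spent on
   the first generation; the other [k] each gain one half. *)
set k := (Num.trunc (lambda / Lam)).-2.
have kE : Num.trunc (lambda / Lam) = k.+2.
  by rewrite /k; case: (Num.trunc _) t0' => [|[|]].
clearbody k; rewrite kE in t1 t2.
have hk1 : s0 + k.+1%:R * Lam <= lambda.
  move: t1; rewrite ler_pdivlMr// -(natr1 k.+1) mulrDl mul1r.
  apply: le_trans; rewrite addrC lerD2l.
  by rewrite ler_peMl ?ler1n// ltW.
have dec := grid_decay (L := L) (t0 := t0) (x0 := x0) (sg := sg) (c0 := c0)
  hp L0 ga0 gaal al1 hm m0 k mG (ltW s00) (ltW eta_gt0) heta.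
have {}dec := dec _ (cheb _ _ _ (measurable_near_part _ _ _ _ _ _) mG hroot).
have main : (mu (root_cell p t0 sg al x0 L `&`
      [set w | (c0 + (s0 + k.+1%:R * (4 * s0)) < G w)%R]) <=
    (2^-1 ^+ k * (2 * D) * (s0 `^ q)^-1)%:E *
    \int[mu]_(z in near_part p sg ga x0 t0 L) ((Num.max (G z - c0) 0) `^ q)%:E)%E.
  apply: le_trans (dec _) _.
    move=> x t l l0 /(hG x t l l0)[c [h1 h2]]; exists c; split.
      exact: cheb (measurable_near_part _ _ _ _ _ _) mG h1.
    (* Lower bounds for [G] on the far part are upper bounds for its negative. *)
    have := cheb _ (\- G) (- c) (measurable_far_part p sg ga x t l).
    have -> : [set w | - c + s0 < (\- G) w] = [set w | G w < c - s0].
      by apply/funext => w; rewrite /= ltrNr opprD opprK.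
    apply; first exact: measurable_funN.
    apply: le_trans h2; rewrite le_eqVlt; apply/orP; left; apply/eqP.
    by apply: eq_integral => z _ /=; rewrite opprK addrC.
  rewrite [in leRHS]EFinM -muleA; apply: lee_wpmul2l.
    by rewrite lee_fin mulr_ge0 ?exprn_ge0 ?mulr_ge0// ltW.
  by apply: powR_chebyshev => //; exact: measurable_near_part.
set J := (\int[mu]_(z in _) _)%E in main *.
have J0 : (0 <= J)%E by apply: integral_ge0 => z _; rewrite lee_fin powR_ge0.
have mroot := measurable_root_cell p t0 al L sg x0.
have mlev a : measurable ([set w | a < G w] : set (spacetime R n)).
  exact: measurable_level.
apply: (@le_trans _ _ (mu (root_cell p t0 sg al x0 L `&`
      [set w | (c0 + (s0 + k.+1%:R * (4 * s0)) < G w)%R]))).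
  have levE : [set z | lambda < Num.max (G z - c0) 0] = [set z | c0 + lambda < G z].
    apply/funext => z; rewrite /= lt_max ltrBrDl.
    by rewrite (ltNge lambda 0) (ltW (lt_le_trans N0 Nlam)) orbF.
  rewrite levE -[leRHS]add0e -(near_root_cell_null p t0 sg x0 L0 al1).
  have m1 : measurable
      (near_part p sg al x0 t0 L `\` root_cell p t0 sg al x0 L : set (spacetime R n)).
    by apply: measurableD => //; exact: measurable_near_part.
  have m2 : measurable (root_cell p t0 sg al x0 L `&`
      [set w | c0 + (s0 + k.+1%:R * (4 * s0)) < G w] : set (spacetime R n)).
    exact: measurableI.
  apply: le_trans (measureU2 mu m1 m2); apply: le_measure; rewrite ?inE.
  - by apply: measurableI => //; exact: measurable_near_part.
  - exact: measurableU.
  - move=> z [nz /= hz]; have [rz|nrz] := pselect (root_cell p t0 sg al x0 L z).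
      right; split => //=; apply: le_lt_trans hz; rewrite lerD2l; exact: hk1.
    by left.
apply: le_trans main _; apply: lee_wpmul2r => //; rewrite lee_fin.
(* Write [2^-k] as [8 * 2^-(k+3)], where [k + 3] exceeds [lambda / (4 * kap * N)]. As
   [lambda / N >= 1] and [q <= 1], the quotient [lambda / N] dominates its power [q]. *)
have E8 : 2^-1 ^+ k <= 8 * expR (- (ln 2 / (4 * kap) * (lambda / N) `^ q)).
  have -> : 2^-1 ^+ k = 8 * expR (- (ln 2 * k.+3%:R)) :> R.
    rewrite -mulNr (mulrC (- _)) expRM_natl expRN lnK ?posrE//.
    by rewrite !exprS; field.
  rewrite ler_pM2l// ler_expR lerN2.
  have ln20 : 0 < ln 2 :> R by rewrite ln_gt0// ltr1n.
  rewrite -mulrA ler_pM2l//.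
  apply: le_trans (ltW t2).
  have : (lambda / N) `^ q <= lambda / N.
    by apply: ler1_powR => //; rewrite ler_pdivlMr// mul1r.
  have k4 : 0 < (4 * kap)^-1 by rewrite invr_gt0 mulr_gt0.
  rewrite -(ler_pM2l k4).
  move=> /le_trans; apply.
  rewrite le_eqVlt; apply/orP; left; apply/eqP; rewrite /Lam /s0; field.
  by rewrite !gt_eqF.
rewrite /s0 powRM ?(ltW kap0) ?(ltW N0)//.
have kq : 0 < kap `^ q by rewrite powR_gt0.
have Nq : 0 < N `^ q by rewrite powR_gt0.
set e := expR _ in E8 *.
rewrite (_ : e * _ = 8 * e * (2 * D) * (kap `^ q * N `^ q)^-1); last first.
  by field; rewrite !gt_eqF.
by rewrite !ler_pM2r ?invr_gt0 ?mulr_gt0.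
Qed.

End one_sided.

Theorem theorem3p1 (R : realType) (n : nat) (p q gamma alpha : R)
  (hn : (1 <= n)%N) (hp : 1 < p)
  (hgamma0 : 0 <= gamma) (hgamma1 : gamma < 1)
  (hgammaalpha : gamma < alpha) (halpha : alpha < 1)
  (hq0 : 0 < q) (hq1 : q <= 1) :
  exists A B C : R, [/\ 0 < A, 0 < B, 0 < C &
    forall (x : 'rV[R]_n) (t L : R) (f : 'rV[R]_n * R -> R),
      0 < L -> PBMO p gamma q x t L f ->
      (0 < PBMO_norm p gamma q x t L f)%E ->
      let N := fine (PBMO_norm p gamma q x t L f) in
      exists c : R, forall lambda : R, C * N <= lambda ->
        (lebesgue_spacetime (prect_upper p alpha x t L `&`
            [set z | lambda < (f \- cst c)^\+ z]%R)
          <= (expR (- (B * (lambda / N) `^ q)) * (A / N `^ q))%R%:E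
             * \int[lebesgue_spacetime]_(z in prect_upper p gamma x t L)
                 ((f \- cst c)^\+ z `^ q)%R%:E)%E /\
        (lebesgue_spacetime (prect_lower p alpha x t L `&`
            [set z | lambda < (f \- cst c)^\- z]%R)
          <= (expR (- (B * (lambda / N) `^ q)) * (A / N `^ q))%R%:E
             * \int[lebesgue_spacetime]_(z in prect_lower p gamma x t L)
                 ((f \- cst c)^\- z `^ q)%R%:E)%E].
Proof.
have al_ga : 0 < alpha - gamma by rewrite subr_gt0.
have gm1 : -1 < gamma by rewrite (lt_le_trans _ hgamma0)// oppr_lt0.
have am1 : -1 < alpha by exact: lt_trans hgammaalpha.
(* The ratio of the grid is fixed before the rectangle and the function, so the constants do not
   depend on them. *)
have [m m0 hm] : exists2 m, (0 < m)%N & 2 <= (alpha - gamma) * time_ratio p m.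
  have [k hk] := @geometric_small R 2 2 _ (lexx 2) al_ga.
  exists k.+1 => //; rewrite -ler_pdivrMl// mulrC.
  apply: le_trans (time_ratio_ge k.+1 hp).
  apply: (@le_trans _ _ (2 ^+ k)).
    by rewrite ler_pdivrMr// mulrC -ler_pdivrMr ?exprn_gt0.
  by rewrite exprS ler_peMl ?exprn_ge0// ler1n.
set kap := level_unit n p q gamma alpha m.
have kap0 : 0 < kap by exact: level_unit_gt0.
set D := dil_const n p alpha m.
have D0 : 0 < D by exact: lt_le_trans (dil_const_ge1 n m hp halpha).
(* In the third constant, [8 * kap] leaves room for two steps of size [4 * kap * N], and the added 1
   ensures [N <= lambda]. *)
exists (16 * D / kap `^ q), (ln 2 / (4 * kap)), (8 * kap + 1); split.
- by rewrite divr_gt0 ?powR_gt0// mulr_gt0.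
- by apply: divr_gt0; [rewrite ln_gt0// ltr1n|rewrite mulr_gt0].
- by rewrite addr_gt0// mulr_gt0.
move=> x t L f L0 [[mf _] Noo] N0 N.
have NE : PBMO_norm p gamma q x t L f = N%:E.
  by rewrite /N fineK// ge0_fin_numE// ltW.
have N_gt0 : 0 < N by rewrite -lte_fin -NE.
pose K := prect p x t L.
have mK : measurable (K : set (spacetime R n)).
  rewrite /K -(of_stime0 t true (L `^ p)) prectE; apply: measurable_spacetime.
  by apply: measurableX; [exact: measurable_cube|exact: measurable_oslab].
(* Extension by zero, which makes the function measurable on all of spacetime. *)
pose F : spacetime R n -> R := f \_ K.
have mF : measurable_fun setT F.
  by have h := (measurable_restrictT (f : spacetime R n -> R) mK).1 mf; exact: h.
have Ff z : K z -> F z = f z by move=> Kz; rewrite /F patchE mem_set.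
have sub := PBMO_sub_rectangle hgamma0 hgamma1 hq0 N_gt0 NE Ff.
(* A near-optimal constant for the whole rectangle, chosen before [lambda] and common to both
   estimates. *)
have [c [hup hlo]] := sub x t L L0 (@subset_refl _ _).
exists c => lambda hlam.
have kN : 8 * kap * N <= lambda.
  by apply: le_trans hlam; rewrite ler_pM2r// lerDl.
have NN : N <= lambda.
  by apply: le_trans hlam; rewrite -[leLHS]mul1r ler_pM2r// lerDr mulr_ge0// ltW.
have est sg G b mG := fun hG hb => @one_sided_estimate R n p q gamma alpha m hp hq0 hq1
  hgamma0 hgammaalpha halpha hm m0 L t x sg G N b lambda L0 mG N_gt0 hG hb kN NN.
have up g z : -1 < g -> prect_upper p g x t L z ->
    (f \- cst c)^\+ z = Num.max (F z - c) 0.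
  by move=> g1 /(near_part_sub (sg := true) g1 L0) Kz; rewrite Ff.
have lo g z : -1 < g -> prect_lower p g x t L z ->
    (f \- cst c)^\- z = Num.max ((\- F) z - - c) 0.
  move=> g1 /(near_part_sub (sg := false) g1 L0) Kz.
  by rewrite /funrneg /= Ff// opprB opprK addrC.
have reflect b z : Num.max ((\- F) z - - b) 0 = Num.max (b - F z) 0.
  by rewrite /= opprK addrC.
have reflect' b z : Num.max (- b - (\- F) z) 0 = Num.max (F z - b) 0.
  by rewrite /= opprK addrC.
split.
- have -> : prect_upper p alpha x t L `&` [set z | lambda < (f \- cst c)^\+ z] =
      near_part p true alpha x t L `&` [set z | lambda < Num.max (F z - c) 0].
    by apply/seteqP; split => z [/= zE]; rewrite (up _ _ am1 zE).
  have -> : (\int[lebesgue_spacetime]_(z in prect_upper p gamma x t L)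
        ((f \- cst c)^\+ z `^ q)%:E =
      \int[lebesgue_spacetime]_(z in near_part p true gamma x t L)
        (Num.max (F z - c) 0 `^ q)%:E)%E.
    by apply: eq_integral => z; rewrite inE => /(up _ _ gm1) ->.
  exact: (est true F c mF sub hup).
- have -> : prect_lower p alpha x t L `&` [set z | lambda < (f \- cst c)^\- z] =
      near_part p false alpha x t L `&` [set z | lambda < Num.max ((\- F) z - - c) 0].
    by apply/seteqP; split => z [/= zE]; rewrite (lo _ _ am1 zE).
  have -> : (\int[lebesgue_spacetime]_(z in prect_lower p gamma x t L)
        ((f \- cst c)^\- z `^ q)%:E =
      \int[lebesgue_spacetime]_(z in near_part p false gamma x t L)
        (Num.max ((\- F) z - - c) 0 `^ q)%:E)%E.
    by apply: eq_integral => z; rewrite inE => /(lo _ _ gm1) ->.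
  (* Reversing time swaps the two parts and negating the function swaps the two inequalities, so the
     negative of [F] satisfies the same hypotheses with constants [- b]. *)
  apply: (est false (\- F) (- c)); first exact: measurable_funN.
    move=> y s l l0 /(sub y s l l0)[b [h1 h2]]; exists (- b); split.
      by under eq_integral do rewrite reflect.
    by under eq_integral do rewrite reflect'.
  by under eq_integral do rewrite reflect.
Qed.
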